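(* Let $K$ be a field, let $\mathcal O$ be an operad in $Vect_K$, let $\mathscr A$, $\mathscr B$ be $\mathcal O$-algebras and let $(C,\phi)$ be a cocommutative measuring of $\mathcal O$-algebras from $\mathscr A$ to $\mathscr B$. Then the induced linear map $$U_{\mathcal O}(\phi):C\longrightarrow \mathrm{Hom}_K(U_{\mathcal O}(\mathscr A),U_{\mathcal O}(\mathscr B)),\qquad U_{\mathcal O}(\phi)(c)(Z(\theta;a_1,\ldots,a_m)):=\sum Z(\theta;\phi(c_1)(a_1),\ldots,\phi(c_m)(a_m))$$ (which is well defined) is a measuring of algebras from $U_{\mathcal O}(\mathscr A)$ to $U_{\mathcal O}(\mathscr B)$.
   Context: Operads are symmetric unital operads in $K$-vector spaces: left $K[S_n]$-modules $\mathcal O(n)$, $n\ge0$, compositions $\gamma$ and unit $\eta:K\to\mathcal O(1)$ with the usual axioms. An $\mathcal O$-algebra is a vector space $\mathscr A$ with structure maps $\mathcal O(n)\otimes\mathscr A^{\otimes n}\to\mathscr A$ ($n\ge0$), written $\theta(a_1,\ldots,a_n)$, satisfying the usual associativity, unitality and equivariance axioms (equivariance: $(\sigma\cdot\theta)(a_1,\ldots,a_n)=\theta(a_{\sigma(1)},\ldots,a_{\sigma(n)})$). For $n=0$ the structure map is $u_{\mathscr A}:\mathcal O(0)\to\mathscr A$. A measuring $(C,\phi)$ of $\mathcal O$-algebras from $\mathscr A$ to $\mathscr B$: a coassociative counital coalgebra $(C,\Delta,\epsilon)$ and a linear map $\phi:C\to \mathrm{Hom}_K(\mathscr A,\mathscr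 B)$ with $\phi(c)(\theta(a_1,\ldots,a_n))=\sum\theta(\phi(c_1)(a_1),\ldots,\phi(c_n)(a_n))$ ($\theta\in\mathcal O(n)$, $n\ge 1$) and $\phi(c)(u_{\mathscr A}(\theta_0))=\epsilon(c)u_{\mathscr B}(\theta_0)$ ($\theta_0\in\mathcal O(0)$), where $\Delta^{n-1}(c)=\sum c_1\otimes\cdots\otimes c_n$. Cocommutative means $C$ is cocommutative. A measuring of (unital associative) algebras from $A$ to $B$ is a coalgebra $C$ and a linear map $\phi:C\to \mathrm{Hom}_K(A,B)$ with $\phi(c)(aa')=\sum\phi(c_1)(a)\phi(c_2)(a')$ and $\phi(c)(1_A)=\epsilon(c)1_B$. Partial compositions: $\circ_i:\mathcal O(m)\otimes\mathcal O(n)\to\mathcal O(m+n-1)$, $1\le i\le m$, obtained from $\gamma$ by inserting the second operation in the $i$-th input and the operad unit in the other inputs. Universal enveloping algebra $U_{\mathcal O}(\mathscr A)$: the vector space generated by symbols $Z(\theta;a_1,\ldots,a_m)$, $\theta\in\mathcal O(m+1)$, $a_i\in\mathscr A$, $m\ge0$, subject to polylinearity in each variable and the relations $Z(\sigma\cdot\theta;a_1,\ldots,a_m)=Z(\theta;a_{\sigma(1)},\ldots,a_{\sigma(m)})$ and $Z(\theta\circ_i\theta';a_1,\ldots,a_{m+n})=Z(\theta;a_1,\ldots,a_{i-1},\theta'(a_i,\ldots,a_{i+n}),a_{i+n+1},\ldots,a_{m+n})$ for $1\le i\le m$, $\sigma\in S_m$ (acting on $\mathcal O(m+1)$ via $S_m\hookrightarrow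 S_{m+1}$), $\theta\in\mathcal O(m+1)$, $\theta'\in\mathcal O(n+1)$. Multiplication: $Z(\theta;a_1,\ldots,a_m)\cdot Z(\mu;b_1,\ldots,b_l)=Z(\theta\circ_{m+1}\mu;a_1,\ldots,a_m,b_1,\ldots,b_l)$; the unit is $Z(\eta(1);\ )$. For $m=0$ the formula for $U_{\mathcal O}(\phi)$ reads $U_{\mathcal O}(\phi)(c)(Z(\theta;\ ))=\epsilon(c)Z(\theta;\ )$. *)

(* Defs.v *)
From HB Require Import structures.
From mathcomp Require Import all_boot all_order all_fingroup all_algebra.
From mathcomp Require Import generic_quotient boolp.
From mathcomp Require Import multinomials.freeg.

Set Implicit Arguments.
Unset Strict Implicit.
Unset Printing Implicit Defensive.

Import GRing.Theory.
Local Open Scope ring_scope.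
Local Open Scope quotient_scope.

Lemma linear_fun0 (K : fieldType) (V W : lmodType K) (f : V -> W) :
  linear f -> f 0 = 0.
Proof. by move=> fL; have := fL (-1) 0 0; rewrite scaler0 addr0 scaleN1r addNr. Qed.

Lemma linear_funZ (K : fieldType) (V W : lmodType K) (f : V -> W) a x :
  linear f -> f (a *: x) = a *: f x.
Proof. by move=> fL; have := fL a x 0; rewrite (linear_fun0 fL) !addr0. Qed.

(* The quotient of V by the subspace spanned by the x - y with R x y. *)
Section LinearQuotient.
Variables (K : fieldType) (V : lmodType K) (R : V -> V -> Prop).

Inductive lspan : V -> Prop :=
| lspan0 : lspan 0
| lspanD (a : K) (x y z : V) : R x y -> lspan z -> lspan (a *: (x - y) + z).

Lemma lspan_lin a x y : lspan x -> lspan y -> lspan (a *: x + y).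
Proof.
move=> sx sy; elim: sx => [|b u v w Ruv _ IH]; first by rewrite scaler0 add0r.
by rewrite scalerDr scalerA -addrA; apply: lspanD.
Qed.

Definition lspan_pred : {pred V} := fun x => `[< lspan x >].

Lemma lspan_zmod_closed : zmod_closed lspan_pred.
Proof.
split; first by apply/asboolP; exact: lspan0.
move=> x y /asboolP sx /asboolP sy; apply/asboolP.
by rewrite addrC -scaleN1r; apply: lspan_lin.
Qed.

HB.instance Definition _ := GRing.isZmodClosed.Build V lspan_pred lspan_zmod_closed.

Definition lquot : Type := Quotient.quot lspan_pred.
HB.instance Definition _ := GRing.Zmodule.on lquot.

Definition lproj (x : V) : lquot := \pi_(Quotient.quot lspan_pred) x.
Definition lrepr (u : lquot) : V :=
  generic_quotient.repr (u : Quotient.quot lspan_pred).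

Lemma lreprK u : lproj (lrepr u) = u. Proof. exact: reprK. Qed.

Lemma lprojP x y : lproj x = lproj y <-> lspan (x - y).
Proof.
rewrite /lproj; split.
  by move=> /eqP; rewrite -Quotient.idealrBE => /asboolP.
by move=> s; apply/eqP; rewrite -Quotient.idealrBE; apply/asboolP.
Qed.

Lemma lprojD x y : lproj (x + y) = lproj x + lproj y.
Proof. exact: Quotient.pi_add. Qed.

Definition lscale (a : K) (u : lquot) : lquot := lproj (a *: lrepr u).

Lemma lproj_scale a x : lproj (a *: x) = lscale a (lproj x).
Proof.
apply/lprojP; rewrite -scalerBr -[_ *: _]addr0.
by apply: lspan_lin lspan0; apply/lprojP; rewrite lreprK.
Qed.

Lemma lscaleA a b u : lscale a (lscale b u) = lscale (a * b) u.
Proof. by rewrite -[u]lreprK -!lproj_scale scalerA. Qed.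
Lemma lscale1 u : lscale 1 u = u.
Proof. by rewrite -[u]lreprK -!lproj_scale scale1r. Qed.
Lemma lscaleDr a u v : lscale a (u + v) = lscale a u + lscale a v.
Proof.
by rewrite -[u]lreprK -[v]lreprK -lprojD -!lproj_scale -lprojD scalerDr.
Qed.
Lemma lscaleDl u a b : lscale (a + b) u = lscale a u + lscale b u.
Proof. by rewrite -[u]lreprK -!lproj_scale -lprojD scalerDl. Qed.

HB.instance Definition _ := GRing.Zmodule_isLmodule.Build K lquot
  lscaleA lscale1 lscaleDr lscaleDl.

Lemma lproj_is_linear : linear lproj.
Proof. by move=> a x y; rewrite lprojD lproj_scale. Qed.
HB.instance Definition _ := GRing.isLinear.Build K V lquot *:%R lproj
  lproj_is_linear.

Lemma lproj_rel x y : R x y -> lproj x = lproj y.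
Proof.
move=> Rxy; apply/lprojP; rewrite -[_ - _]addr0 -[_ - _]scale1r.
by apply: lspanD => //; exact: lspan0.
Qed.

Section Lift.
Variables (W : lmodType K) (f : {linear V -> W}).
Hypothesis fR : forall x y, R x y -> f x = f y.

Definition llift (u : lquot) : W := f (lrepr u).

Lemma lliftE x : llift (lproj x) = f x.
Proof.
apply/eqP; rewrite -subr_eq0 -linearB; apply/eqP.
have /lprojP: lproj (lrepr (lproj x)) = lproj x by rewrite lreprK.
elim=> [|a y z w Ryz _ IH]; first by rewrite linear0.
by rewrite linearP IH linearB (fR Ryz) subrr scaler0 addr0.
Qed.

Lemma llift_is_linear : linear llift.
Proof.
by move=> a u v; rewrite -[u]lreprK -[v]lreprK -linearP !lliftE linearP.
Qed.
End Lift.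

End LinearQuotient.

Section FreeModule.
Variables (K : fieldType) (T : choiceType).
Local Notation F := {freeg T / K}.

Definition fgen (x : T) : F := Freeg [:: (1, x)].

Lemma Freeg1 (a : K) (x : T) : Freeg [:: (a, x)] = a *: fgen x.
Proof. by apply/eqP/freeg_eqP => y; rewrite coeffZ !coeffU mul1r. Qed.

Lemma freeg_gen (P : F -> Prop) :
  P 0 -> (forall a x y, P y -> P (a *: fgen x + y)) -> forall y, P y.
Proof.
move=> P0 PD; apply: freeg_ind_dom0 => // k x D _ _ PD'.
by rewrite Freeg1; apply: PD.
Qed.

Variables (W : lmodType K) (f : T -> W).

Lemma fglift_gen x : fglift f (fgen x) = f x.
Proof. by rewrite liftU scale1r. Qed.

Lemma fglift_sum (D : F) : fglift f D = \sum_(p <- fgenum D) p.1 *: f p.2.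
Proof. by rewrite -{1}[D]Freeg_enum fglift_Freeg. Qed.

Lemma fglift_is_linear : linear (fglift f : F -> W).
Proof.
have fB : {morph (fglift f : F -> W) : x y / x - y} := lift_is_additive f.
have f0 : fglift f (0 : F) = 0 by rewrite -[0 in LHS](subrr 0) fB subrr.
have fD : {morph (fglift f : F -> W) : x y / x + y}.
  by move=> x y; rewrite -[y in LHS]opprK fB -[- y]sub0r fB f0 sub0r opprK.
move=> a; suff fZ (x : F) : fglift f (a *: x) = a *: fglift f x.
  by move=> x y; rewrite fD fZ.
have fU k y : fglift f (k *: fgen y) = k *: f y by rewrite -Freeg1 liftU.
pose P x := fglift f (a *: x) = a *: fglift f x.
apply: (freeg_gen (P := P)); rewrite /P; first by rewrite scaler0 f0 scaler0.
move=> b {}x y IH.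
by rewrite scalerDr scalerA !fD IH !fU scalerDr scalerA.
Qed.
HB.instance Definition _ := GRing.isLinear.Build K F W *:%R
  (fglift f : F -> W) fglift_is_linear.
End FreeModule.

Section Tensor.
Variables (K : fieldType) (V W : lmodType K).
Local Notation F := {freeg (V * W)%type / K}.

Inductive tens_rel : F -> F -> Prop :=
| tens_rell (a : K) (x x' : V) (y : W) :
    tens_rel (fgen K (a *: x + x', y)) (a *: fgen K (x, y) + fgen K (x', y))
| tens_relr (a : K) (x : V) (y y' : W) :
    tens_rel (fgen K (x, a *: y + y')) (a *: fgen K (x, y) + fgen K (x, y')).

Definition tensor : Type := lquot tens_rel.
HB.instance Definition _ := GRing.Lmodule.on tensor.

Definition tens (x : V) (y : W) : tensor := lproj tens_rel (fgen K (x, y)).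

(* A finite family (x_k, y_k) with t = \sum_k x_k (x) y_k, cf. tens_seqE. *)
Definition tens_seq (t : tensor) : seq (V * W) :=
  [seq (p.1 *: p.2.1, p.2.2) | p <- fgenum (lrepr t)].

Lemma tens_linl y : linear (fun x => tens x y).
Proof.
by move=> a x x'; rewrite /tens (lproj_rel (tens_rell _ _ _ _)) linearP.
Qed.

Lemma tens_linr x : linear (tens x).
Proof.
by move=> a y y'; rewrite /tens (lproj_rel (tens_relr _ _ _ _)) linearP.
Qed.

Section Lift.
Variables (X : lmodType K) (f : V -> W -> X).
Hypothesis f_linl : forall y, linear (f^~ y).
Hypothesis f_linr : forall x, linear (f x).

Let f_rel (x y : F) : tens_rel x y ->
  fglift (fun p => f p.1 p.2) x = fglift (fun p => f p.1 p.2) y.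
Proof.
by case=> *; rewrite linearP /= !fglift_gen /= ?f_linl ?f_linr.
Qed.

Lemma tens_seq_lift (t : tensor) :
  \sum_(p <- tens_seq t) f p.1 p.2 = llift (fglift (fun p => f p.1 p.2)) t.
Proof.
rewrite /llift /= fglift_sum big_map; apply: eq_bigr => p _ /=.
by rewrite (linear_funZ _ _ (f_linl _)).
Qed.

(* Sums of bilinear expressions over tens_seq t do not depend on the chosen
   decomposition of t. *)
Lemma tens_seq_bilin (t : tensor) (s : seq (V * W)) :
  t = \sum_(p <- s) tens p.1 p.2 ->
  \sum_(p <- tens_seq t) f p.1 p.2 = \sum_(p <- s) f p.1 p.2.
Proof.
move=> ->; rewrite tens_seq_lift.
pose g : {linear tensor -> X} := HB.pack (llift (fglift (fun p => f p.1 p.2)))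
  (GRing.isLinear.Build K tensor X *:%R _ (llift_is_linear f_rel)).
rewrite -[llift _]/(g : _ -> _) linear_sum; apply: eq_bigr => p _.
by apply: etrans (lliftE f_rel (fgen K (p.1, p.2))) _; rewrite /= fglift_gen.
Qed.
End Lift.

Lemma tens_seqE (t : tensor) : \sum_(p <- tens_seq t) tens p.1 p.2 = t.
Proof.
rewrite -[RHS]lreprK big_map -[lrepr t in RHS]Freeg_enum.
elim: (fgenum _) => [|[a [x y]] s IH].
  by rewrite big_nil freeg_nil linear0.
rewrite big_cons IH -cat1s freeg_cat linearD; congr (_ + _) => /=.
rewrite Freeg1 linearZ /=.
by rewrite (linear_funZ _ _ (tens_linl _)).
Qed.
End Tensor.

Record coalgebra (K : fieldType) := Coalgebra {
  coalg_space :> lmodType K;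
  coproduct : {linear coalg_space -> tensor coalg_space coalg_space};
  counit : {scalar coalg_space};
  coproductA : forall c,
    \sum_(p <- tens_seq (coproduct c)) tens p.1 (coproduct p.2) =
    \sum_(p <- tens_seq (coproduct c)) \sum_(q <- tens_seq (coproduct p.1))
       tens q.1 (tens q.2 p.2);
  counitl : forall c,
    \sum_(p <- tens_seq (coproduct c)) counit p.1 *: p.2 = c;
  counitr : forall c,
    \sum_(p <- tens_seq (coproduct c)) counit p.2 *: p.1 = c
}.

Section Sweedler.
Variables (K : fieldType) (C : coalgebra K).

(* Sweedler notation: coproduct c = \sum_(p <- sweedler c) p.1 (x) p.2. *)
Definition sweedler (c : C) : seq (C * C) := tens_seq (coproduct C c).

Definition cocommutative : Prop := forall c : C,
  \sum_(p <- sweedler c) tens p.2 p.1 = coproduct C c.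

(* The n-fold iterate of the coproduct, as a sum of (n+1)-tuples. *)
Fixpoint isweedler (n : nat) (c : C) : seq (n.+1.-tuple C) :=
  if n is n'.+1 then
    flatten [seq [seq cons_tuple p.1 t | t <- isweedler n' p.2]
            | p <- sweedler c]
  else [:: [tuple c]].

(* \sum f (c_1, ..., c_n), where c_1, ..., c_n come from the (n-1)-fold
   coproduct of c; for n = 0 this is counit c *: f (). *)
Definition sweedler_sum (V : lmodType K) (n : nat) :
    (n.-tuple C -> V) -> C -> V :=
  match n with
  | 0 => fun f c => counit C c *: f [tuple]
  | n'.+1 => fun f c => \sum_(t <- isweedler n' c) f t
  end.
End Sweedler.

(* op_comp x ys is gamma (x; y_1, ..., y_m), and op_unit is eta 1. *)
Record operad (K : fieldType) := Operad {
  op_space :> nat -> lmodType K;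
  op_act : forall n, 'S_n -> op_space n -> op_space n;
  op_comp : forall (m : nat) (n : 'I_m -> nat),
    op_space m -> (forall i, op_space (n i)) -> op_space (\sum_i n i)%N;
  op_unit : op_space 1;

  op_act_linear : forall n (s : 'S_n), linear (op_act s);
  op_act1 : forall n (x : op_space n), op_act 1%g x = x;
  (* A left action: in MathComp (s * t)%g is "s, then t". *)
  op_actM : forall n (s t : 'S_n) (x : op_space n),
    op_act (t * s)%g x = op_act s (op_act t x);

  op_comp_linearl : forall m (n : 'I_m -> nat) (ys : forall i, op_space (n i)),
    linear (fun x => op_comp x ys);
  op_comp_linearr : forall m (n : 'I_m -> nat) (x : op_space m)
      (ys : forall i, op_space (n i)) (i : 'I_m),
    linear (fun y : op_space (n i) => op_comp x (dfwith ys y));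

  (* The two sides of the following axioms live in op_space of two arities
     that are provably but not definitionally equal; the equations are stated
     in the sigma type {n & op_space n}, which is equivalent to transporting
     one side along the equality of arities. *)
  op_compl1 : forall n (x : op_space n),
    Tagged op_space (op_comp (n := fun _ : 'I_1 => n) op_unit (fun _ => x)) =
    Tagged op_space x;
  op_compr1 : forall n (x : op_space n),
    Tagged op_space (op_comp (n := fun _ : 'I_n => 1%N) x (fun _ => op_unit)) =
    Tagged op_space x;
  op_compA : forall m (n : 'I_m -> nat) (r : forall i, 'I_(n i) -> nat)
      (x : op_space m) (ys : forall i, op_space (n i))
      (zs : forall i j, op_space (r i j)),
    Tagged op_space (op_comp x (fun i => op_comp (ys i) (zs i))) =
    Tagged op_space (op_comp (op_comp x ys)
      (fun k => zs (tagnat.sig1 k) (tagnat.sig2 k)));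

  (* Equivariance. tagnat.Rank i j is the position of the j-th input of the
     i-th block; t is the block sum of the s i in the first axiom, and the
     block permutation induced by s in the second one. *)
  op_comp_actr : forall m (n : 'I_m -> nat) (s : forall i, 'S_(n i))
      (t : 'S_(\sum_i n i)) (x : op_space m) (ys : forall i, op_space (n i)),
    (forall i j, t (tagnat.Rank i j) = tagnat.Rank i (s i j)) ->
    op_comp x (fun i => op_act (s i) (ys i)) = op_act t (op_comp x ys);
  op_comp_actl : forall m (n : 'I_m -> nat) (s : 'S_m)
      (e : (\sum_i n (s i) = \sum_i n i)%N) (t : 'S_(\sum_i n i))
      (x : op_space m) (ys : forall i, op_space (n i)),
    (forall i (j : 'I_(n (s i))),
       t (cast_ord e (@tagnat.Rank m (fun i => n (s i)) i j)) =
       tagnat.Rank (s i) j) ->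
    op_comp (op_act s x) ys =
    op_act t (ecast k (op_space k) e (op_comp x (fun i => ys (s i))))
}.

Definition upd (n : nat) (A : Type) (a : A ^ n) (i : 'I_n) (x : A) : A ^ n :=
  [ffun j => if j == i then x else a j].

Record op_algebra (K : fieldType) (O : operad K) := OpAlgebra {
  opalg_space :> lmodType K;
  opalg_act : forall n, O n -> opalg_space ^ n -> opalg_space;
  opalg_act_linearl : forall n (a : opalg_space ^ n),
    linear (fun x : O n => opalg_act x a);
  opalg_act_linearr : forall n (x : O n) (a : opalg_space ^ n) (i : 'I_n),
    linear (fun y => opalg_act x (upd a i y));
  opalg_act_comp : forall m (n : 'I_m -> nat) (x : O m)
      (ys : forall i, O (n i)) (a : opalg_space ^ (\sum_i n i)%N),
    opalg_act (op_comp x ys) a =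
    opalg_act x [ffun i => opalg_act (ys i) [ffun j => a (tagnat.Rank i j)]];
  opalg_act_unit : forall a : opalg_space ^ 1,
    opalg_act (op_unit O) a = a ord0;
  opalg_act_perm : forall n (s : 'S_n) (x : O n) (a : opalg_space ^ n),
    opalg_act (op_act s x) a = opalg_act x [ffun i => a (s i)]
}.

Section PartialComposition.
Variables (K : fieldType) (O : operad K).

Definition op_cast (m n : nat) (e : m = n) (x : O m) : O n :=
  ecast k (O k) e x.

Definition plug (b : bool) (n : nat) (y : O n) : O (if b then n else 1%N) :=
  if b return O (if b then n else 1%N) then y else op_unit O.

Lemma sum_plug (m n : nat) (i : 'I_m) :
  (\sum_j (if j == i then n else 1) = (m + n).-1)%N.
Proof.
rewrite (bigD1 i) //= eqxx (eq_bigr (fun=> 1%N)) => [|j /negPf -> //].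
rewrite sum1_card (_ : #|_| = m.-1); last first.
  by rewrite -[in RHS](card_ord m) -(cardC1 i); apply: eq_card.
by case: m i => [[] //|m] i /=; rewrite addnC.
Qed.

(* Partial composition at the i-th input, counting inputs from 0. *)
Definition op_circ (m n : nat) (i : 'I_m) (x : O m) (y : O n) : O (m + n).-1 :=
  op_cast (sum_plug n i) (op_comp x (fun j => plug (j == i) y)).

Lemma op_circS_arity (m n : nat) : ((m.+1 + n.+1).-1 = (m + n).+1)%N.
Proof. by rewrite addSn addnS. Qed.

Definition op_circS (m n : nat) (i : 'I_m.+1) (x : O m.+1) (y : O n.+1) :
    O (m + n).+1 :=
  op_cast (op_circS_arity m n) (op_circ i x y).
End PartialComposition.

Definition ffcat (m n : nat) (A : Type) (a : A ^ m) (b : A ^ n) : A ^ (m + n) :=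
  [ffun k => match split k with inl i => a i | inr j => b j end].

Section Enveloping.
Variables (K : fieldType) (O : operad K) (A : op_algebra O).

Definition env_gen := {m : nat & (O m.+1 * A ^ m)%type}.
HB.instance Definition _ := Choice.on env_gen.
Local Notation F := {freeg env_gen / K}.

Definition env_sym (m : nat) (x : O m.+1) (a : A ^ m) : F :=
  fgen K (existT (fun m => (O m.+1 * A ^ m)%type) m (x, a) : env_gen).

Lemma ins_ord_lt (m n : nat) (i : 'I_m) (k : 'I_n.+1) : (i + k < m + n)%N.
Proof. by rewrite -addSn leq_add // -ltnS. Qed.

(* Counting inputs from 1:
   (a_1, ..., a_(i-1), y(a_i, ..., a_(i+n)), a_(i+n+1), ..., a_(m+n)) *)
Definition ins_op (m n : nat) (i : 'I_m) (y : O n.+1) (a : A ^ (m + n)) : A ^ m :=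
  [ffun j : 'I_m =>
     if (j < i)%N then a (lshift n j)
     else if j == i then
       opalg_act y [ffun k : 'I_n.+1 => a (Ordinal (ins_ord_lt i k))]
     else a (cast_ord (addnC n m) (rshift n j))].

(* lift_perm ord_max ord_max : S_m -> S_(m+1) extends s by fixing the last
   input, and the cast in op_circS is along (m + 1) + (n + 1) - 1 = m + n + 1. *)
Inductive env_rel : F -> F -> Prop :=
| env_rel_linl m k (x x' : O m.+1) (a : A ^ m) :
    env_rel (env_sym (k *: x + x') a) (k *: env_sym x a + env_sym x' a)
| env_rel_linr m (x : O m.+1) (a : A ^ m) (i : 'I_m) k (b b' : A) :
    env_rel (env_sym x (upd a i (k *: b + b')))
            (k *: env_sym x (upd a i b) + env_sym x (upd a i b'))
| env_rel_perm m (s : 'S_m) (x : O m.+1) (a : A ^ m) :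
    env_rel (env_sym (op_act (lift_perm ord_max ord_max s) x) a)
            (env_sym x [ffun i => a (s i)])
| env_rel_comp m n (i : 'I_m) (x : O m.+1) (y : O n.+1) (a : A ^ (m + n)) :
    env_rel (env_sym (op_circS (widen_ord (leqnSn m) i) x y) a)
            (env_sym x (ins_op i y a)).

Definition env : Type := lquot env_rel.
HB.instance Definition _ := GRing.Lmodule.on env.

Definition envZ (m : nat) (x : O m.+1) (a : A ^ m) : env :=
  lproj env_rel (env_sym x a).
End Enveloping.

Section PartialCompositionTheory.
Variables (K : fieldType) (O : operad K).

Definition same (m n : nat) (x : O m) (y : O n) : Prop :=
  Tagged (fun k => O k) x = Tagged (fun k => O k) y.

Lemma same_sym m n (x : O m) (y : O n) : same x y -> same y x.
Proof. exact: esym. Qed.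

Lemma same_trans m n k (y : O n) (x : O m) (z : O k) :
  same x y -> same y z -> same x z.
Proof. exact: etrans. Qed.

Lemma same_arity m n (x : O m) (y : O n) : same x y -> m = n.
Proof. exact: (congr1 (@tag _ _)). Qed.

Lemma same_eq n (x y : O n) : same x y -> x = y.
Proof. by move=> /eqP; rewrite eq_Tagged => /eqP. Qed.

Lemma same_cast m n (e : m = n) (x : O m) : same (op_cast e x) x.
Proof. by case: n / e. Qed.

Lemma same_castE m n (e : m = n) (x : O m) (y : O n) : same x y -> op_cast e x = y.
Proof. by case: n / e y => y /same_eq. Qed.

Lemma same_act m n (x : O m) (y : O n) (s : 'S_m) (t : 'S_n) :
  same x y -> (forall (i : 'I_m) (j : 'I_n), i = j :> nat -> s i = t j :> nat) ->
  same (op_act s x) (op_act t y).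
Proof.
move=> xy; have e := same_arity xy; case: n / e y t xy => y t /same_eq -> st.
by congr (Tagged (fun k => O k) (op_act _ _)); apply/permP => i; apply/val_inj/st.
Qed.

Lemma same_comp m m' (n : 'I_m -> nat) (n' : 'I_m' -> nat) (x : O m) (x' : O m')
    (ys : forall i, O (n i)) (ys' : forall i, O (n' i)) :
  same x x' -> (forall (i : 'I_m) (j : 'I_m'), i = j :> nat -> same (ys i) (ys' j)) ->
  same (op_comp x ys) (op_comp x' ys').
Proof.
move=> xx; have e := same_arity xx; case: m' / e x' n' ys' xx => x' n' ys' /same_eq -> H.
have en : n' = n by apply/funext => i; rewrite (same_arity (H i i erefl)).
subst n'.
congr (Tagged (fun k => O k) (op_comp _ _)); apply: functional_extensionality_dep => i.
exact/same_eq/H.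
Qed.

Lemma same_plug (b b' : bool) n (y : O n) : b = b' -> same (plug b y) (plug b' y).
Proof. by move->. Qed.

Lemma same_plugT n (y : O n) : same (plug true y) y. Proof. by []. Qed.

Lemma same_plug1 b : same (plug b (op_unit O)) (op_unit O).
Proof. by case: b. Qed.

Lemma same_circ m n (i : 'I_m) (x : O m) (y : O n) :
  same (op_circ i x y) (op_comp x (fun j => plug (j == i) y)).
Proof. exact: same_cast. Qed.

Lemma same_circS m n (i : 'I_m.+1) (x : O m.+1) (y : O n.+1) :
  same (op_circS i x y) (op_comp x (fun j => plug (j == i) y)).
Proof. by apply: same_trans (same_cast _ _) _; apply: same_cast. Qed.

Lemma same_comp1 n (x : O n) (k : 'I_1 -> nat) (y : forall i, O (k i)) :
  same (y ord0) x -> same (op_comp (op_unit O) y) x.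
Proof.
move=> yx; apply: same_trans (op_compl1 x).
by apply: same_comp => // i j _; rewrite !ord1.
Qed.

Lemma same_compr1 m (x : O m) (n : 'I_m -> nat) (ys : forall i, O (n i)) :
  (forall i, same (ys i) (op_unit O)) -> same (op_comp x ys) x.
Proof.
by move=> y1; apply: same_trans (op_compr1 x); apply: same_comp.
Qed.

Lemma Rank_ones m (p : 'I_m -> nat) (i : 'I_m) (j : 'I_(p i)) :
  (forall k : 'I_m, (k < i)%N -> p k = 1%N) -> tagnat.Rank i j = (i + j)%N :> nat.
Proof.
move=> p1; rewrite tagnat.RankEsum; congr (_ + _)%N.
rewrite (eq_bigr (fun=> 1%N)) //.
rewrite -(big_ord_widen _ (fun=> 1%N) (ltnW (ltn_ord i))).
by rewrite sum1_card card_ord.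
Qed.

Lemma plug_arityN (m n : nat) (i k : 'I_m) :
  k != i -> (if k == i then n else 1%N) = 1%N.
Proof. by move/negPf->. Qed.

Lemma Rank_plug m n (i : 'I_m) (j : 'I_m)
    (k : 'I_(if j == i then n else 1)) :
  (j <= i)%N ->
  @tagnat.Rank m (fun j => if j == i then n else 1%N) j k = (j + k)%N :> nat.
Proof.
move=> ji; apply: (@Rank_ones m (fun j => if j == i then n else 1%N)) => l lj.
by apply: plug_arityN; rewrite -val_eqE neq_ltn (leq_trans lj ji).
Qed.

(* x o_i (y o_j z) = (x o_i y) o_(i+j) z *)
Lemma same_circA m n r (i : 'I_m) (j : 'I_n) (x : O m) (y : O n) (z : O r)
    l (p : 'I_l) (w : O l) :
  p = (i + j)%N :> nat -> same w (op_circ i x y) ->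
  same (op_circ i x (op_circ j y z)) (op_circ p w z).
Proof.
move=> pij ww; apply: same_trans (same_circ _ _ _) _.
pose zs a (b : 'I_(if a == i then n else 1%N)) :=
  plug ((a == i) && (b == j :> nat)) z.
have H : same (op_comp x (fun a => plug (a == i) (op_circ j y z)))
              (op_comp x (fun a => op_comp (plug (a == i) y) (zs a))).
  apply: same_comp => // a a' /val_inj ->; rewrite /zs.
  case: (a' == i) => /=.
    apply: same_trans (same_circ _ _ _) _.
    by apply: same_comp => // b b' /val_inj ->; apply: same_plug.
  by apply: same_sym; apply: same_comp1.
apply: same_trans H _; apply: same_trans (op_compA _ _ _) _.
apply: same_sym; apply: same_trans (same_circ _ _ _) _.
apply: same_comp.
  by apply: same_trans ww _; apply: same_circ.
move=> s t st; rewrite /zs; apply: same_plug.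
have ji : (j < if i == i then n else 1)%N by rewrite eqxx.
have pE : p = tagnat.Rank (p_ := fun a => if a == i then n else 1%N) i
                (Ordinal ji) :> nat by rewrite Rank_plug.
by rewrite -val_eqE /= st pE -[t in LHS]tagnat.sig2K tagnat.eq_Rank.
Qed.

(* Both sides of the parallel axiom (x o_i y) o z = (x o z) o_i y. *)
Lemma same_circ_par m n r (i k : 'I_m) (x : O m) (y : O n) (z : O r)
    l (p : 'I_l) (w : O l) l' (p' : 'I_l') (w' : O l') :
  i != k ->
  same w (op_circ i x y) -> same w' (op_circ k x z) ->
  (forall (s : 'I_l) (t : 'I_(\sum_j if j == i then n else 1)%N),
     s = t :> nat -> (s == p) = (tagnat.sig1 t == k)) ->
  (forall (s : 'I_l') (t : 'I_(\sum_j if j == k then r else 1)%N),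
     s = t :> nat -> (s == p') = (tagnat.sig1 t == i)) ->
  same (op_circ p w z) (op_circ p' w' y).
Proof.
move=> ik ww ww' Hp Hp'.
pose ys j := op_comp (plug (j == i) y) (fun=> plug (j == k) z).
pose zs j := op_comp (plug (j == k) z) (fun=> plug (j == i) y).
have L : same (op_circ p w z) (op_comp x ys).
  apply: same_trans (same_circ _ _ _) _; apply: same_sym.
  apply: same_trans (op_compA _ _ _) _; apply: same_comp.
    by apply: same_sym; apply: same_trans ww _; apply: same_circ.
  by move=> s t /esym st; apply: same_plug; rewrite (Hp _ _ st).
have R : same (op_circ p' w' y) (op_comp x zs).
  apply: same_trans (same_circ _ _ _) _; apply: same_sym.
  apply: same_trans (op_compA _ _ _) _; apply: same_comp.
    by apply: same_sym; apply: same_trans ww' _; apply: same_circ.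
  by move=> s t /esym st; apply: same_plug; rewrite (Hp' _ _ st).
apply: same_trans L _; apply: same_trans (same_sym R).
apply: same_comp => // a b /val_inj ->; rewrite /ys /zs.
have [->|bi] := eqVneq b i; rewrite ?(negPf ik) /=.
  apply: (@same_trans _ _ _ y); first exact: same_compr1.
  by apply: same_sym; apply: same_comp1.
case: (b == k) => /=.
  apply: (@same_trans _ _ _ z); first exact: same_comp1.
  by apply: same_sym; apply: same_compr1.
by apply: (@same_trans _ _ _ (op_unit O)); [|apply: same_sym]; apply: same_comp1.
Qed.

Definition sum_perm_fun m n (s : 'S_m) (t : 'S_n) (k : 'I_(m + n)) : 'I_(m + n) :=
  match split k with inl i => lshift n (s i) | inr j => rshift m (t j) end.

Lemma sum_perm_lshift_fun m n (s : 'S_m) (t : 'S_n) i :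
  sum_perm_fun s t (lshift n i) = lshift n (s i).
Proof. by rewrite /sum_perm_fun (unsplitK (inl i)). Qed.

Lemma sum_perm_rshift_fun m n (s : 'S_m) (t : 'S_n) i :
  sum_perm_fun s t (rshift m i) = rshift m (t i).
Proof. by rewrite /sum_perm_fun (unsplitK (inr i)). Qed.

Lemma sum_perm_inj m n (s : 'S_m) (t : 'S_n) : injective (sum_perm_fun s t).
Proof.
apply: (can_inj (g := sum_perm_fun s^-1%g t^-1%g)) => k.
case: (split_ordP k) => i ->.
  by rewrite !sum_perm_lshift_fun permK.
by rewrite !sum_perm_rshift_fun permK.
Qed.

Definition sum_perm m n (s : 'S_m) (t : 'S_n) : 'S_(m + n) :=
  perm (@sum_perm_inj m n s t).

Lemma sum_perm_lshift m n (s : 'S_m) (t : 'S_n) i :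
  sum_perm s t (lshift n i) = lshift n (s i).
Proof. by rewrite permE sum_perm_lshift_fun. Qed.

Lemma sum_perm_rshift m n (s : 'S_m) (t : 'S_n) i :
  sum_perm s t (rshift m i) = rshift m (t i).
Proof. by rewrite permE sum_perm_rshift_fun. Qed.

Definition lift_last m (s : 'S_m) : 'S_m.+1 := lift_perm ord_max ord_max s.

Lemma lift_lastE m (s : 'S_m) (k : 'I_m.+1) (i : 'I_m) :
  k = i :> nat -> lift_last s k = s i :> nat.
Proof.
move=> ki; have -> : k = fintype.lift ord_max i by apply: ord_inj; rewrite lift_max.
by rewrite /lift_last lift_perm_lift lift_max.
Qed.

Lemma lift_last_max m (s : 'S_m) (k : 'I_m.+1) :
  k = m :> nat -> lift_last s k = m :> nat.
Proof.
move=> ki; have -> : k = ord_max by apply: val_inj.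
by rewrite /lift_last lift_perm_id.
Qed.

Lemma op_circS_actl m n (s : 'S_m) (x : O m.+1) (y : O n.+1) :
  op_circS ord_max (op_act (lift_last s) x) y =
  op_act (lift_last (sum_perm s 1)) (op_circS ord_max x y).
Proof.
apply: same_eq; apply: same_trans (same_circS _ _ _) _.
pose p (j : 'I_m.+1) := if j == ord_max then n.+1 else 1%N.
have pE j : p (lift_last s j) = p j.
  rewrite /p; congr (if _ then _ else _).
  by rewrite -[X in _ == X](lift_perm_id ord_max ord_max s) (inj_eq perm_inj).
have e : (\sum_i p (lift_last s i) = \sum_i p i)%N by apply: eq_bigr.
have RP a (b : 'I_(p a)) : @tagnat.Rank _ p a b = (a + b)%N :> nat.
  exact: (@Rank_plug m.+1 n.+1 ord_max a b (leq_ord a)).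
have ar : ((m + n).+1 = \sum_i p i)%N.
  by rewrite (sum_plug n.+1 (ord_max : 'I_m.+1)) addSn addnS.
pose t := cast_perm ar (lift_last (sum_perm s 1)).
have Ht i (j : 'I_(p (lift_last s i))) :
    t (cast_ord e (@tagnat.Rank _ (fun i => p (lift_last s i)) i j)) =
    @tagnat.Rank _ p (lift_last s i) j.
  apply: ord_inj; rewrite RP /t cast_permE.
  rewrite -[LHS]/(nat_of_ord (lift_last _ _)).
  set k := cast_ord _ _.
  have kE : k = (i + j)%N :> nat.
    rewrite -[LHS]/(nat_of_ord (@tagnat.Rank _ (fun i => p (lift_last s i)) i j)).
    rewrite (@Rank_ones _ (fun i => p (lift_last s i))) // => l li.
    rewrite pE /p plug_arityN // -val_eqE neq_ltn /=.
    by rewrite (leq_trans li (leq_ord i)).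
  have [im|] := eqVneq i ord_max.
    have sm : lift_last s i = m :> nat by apply: lift_last_max; rewrite im.
    rewrite sm; have jn : (j < n.+1)%N.
      move: (ltn_ord j); rewrite {2}/p.
      by rewrite (_ : _ == _) // -val_eqE /= sm.
    have iv : i = m :> nat by rewrite im.
    rewrite iv in kE.
    have [jl|jl] := ltnP j n.
      rewrite (lift_lastE _ (i := rshift m (Ordinal jl))) //.
      by rewrite sum_perm_rshift perm1.
    have jn' : j = n :> nat by apply/eqP; rewrite eqn_leq jl -ltnS jn.
    by rewrite lift_last_max ?kE jn'.
  rewrite -val_eqE /= => im; have il : (i < m)%N.
    by rewrite ltn_neqAle im -ltnS ltn_ord.
  have j0 : j = 0%N :> nat.
    have := ltn_ord j; rewrite {2}pE {2}/p plug_arityN; last by rewrite -val_eqE.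
    by rewrite ltnS leqn0 => /eqP.
  rewrite (lift_lastE _ (i := lshift n (Ordinal il))) ?kE ?j0 ?addn0 //.
  by rewrite sum_perm_lshift /= (lift_lastE _ (i := Ordinal il)).
rewrite /same (op_comp_actl _ _ Ht) -/(op_cast _ _).
apply: same_act => [|a b ab].
  apply: same_trans (same_cast _ _) _; apply: same_sym.
  apply: same_trans (same_circS _ _ _) _; apply: same_comp => // a b /val_inj ->.
  apply: same_plug.
  by rewrite -[X in _ = (_ == X)](lift_perm_id ord_max ord_max s) (inj_eq perm_inj).
rewrite /t cast_permE /=; congr (nat_of_ord (lift_last _ _)).
exact: val_inj.
Qed.

Definition plug_perm (b : bool) n (s : 'S_n) : 'S_(if b then n else 1%N) :=
  if b return 'S_(if b then n else 1%N) then s else 1%g.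

Lemma op_circS_actr m n (s : 'S_n) (x : O m.+1) (y : O n.+1) :
  op_circS ord_max x (op_act (lift_last s) y) =
  op_act (lift_last (sum_perm 1 s)) (op_circS ord_max x y).
Proof.
apply: same_eq; apply: same_trans (same_circS _ _ _) _.
pose p (j : 'I_m.+1) := if j == ord_max then n.+1 else 1%N.
have RP a (b : 'I_(p a)) : @tagnat.Rank _ p a b = (a + b)%N :> nat.
  exact: (@Rank_plug m.+1 n.+1 ord_max a b (leq_ord a)).
have ar : ((m + n).+1 = \sum_i p i)%N.
  by rewrite (sum_plug n.+1 (ord_max : 'I_m.+1)) addSn addnS.
pose t := cast_perm ar (lift_last (sum_perm 1 s)).
pose ss i : 'S_(p i) := plug_perm (i == ord_max) (lift_last s).
have -> : (fun j : 'I_m.+1 => plug (j == ord_max) (op_act (lift_last s) y)) =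
          (fun j => op_act (ss j) (plug (j == ord_max) y)).
  apply: functional_extensionality_dep => j; rewrite /ss /p.
  by case: (j == ord_max) => //=; rewrite op_act1.
rewrite /same (@op_comp_actr _ _ _ _ ss t); last first.
  move=> i j; apply: ord_inj; rewrite RP /t cast_permE.
  rewrite -[LHS]/(nat_of_ord (lift_last _ _)); set k := cast_ord _ _.
  have kE : k = (i + j)%N :> nat by rewrite -[LHS]/(nat_of_ord (@tagnat.Rank _ p i j)) RP.
  have [im|] := eqVneq i ord_max.
    move: j k kE; rewrite /ss {}im /p eqxx /= => j k kE.
    have [jl|jl] := ltnP j n.
      rewrite (lift_lastE _ (i := rshift m (Ordinal jl))) //.
      by rewrite sum_perm_rshift /= (lift_lastE _ (i := Ordinal jl)).
    have jn : j = n :> nat by apply/eqP; rewrite eqn_leq jl -ltnS ltn_ord.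
    by rewrite lift_last_max ?kE ?jn // (lift_last_max _ (k := j)).
  move=> im; have il : (i < m)%N.
    by rewrite ltn_neqAle -[m]/(val (ord_max : 'I_m.+1)) val_eqE im -ltnS ltn_ord.
  have j0 (a : 'I_(p i)) : a = 0%N :> nat.
    have := ltn_ord a; rewrite {2}/p plug_arityN //.
    by rewrite ltnS leqn0 => /eqP.
  rewrite j0 (lift_lastE _ (i := lshift n (Ordinal il))) ?kE ?j0 ?addn0 //.
  by rewrite sum_perm_lshift perm1.
apply: same_act => [|a b ab].
  by apply: same_sym; apply: same_circS.
rewrite /t cast_permE /=; congr (nat_of_ord (lift_last _ _)).
exact: val_inj.
Qed.

Lemma op_circS_par m n r (i : 'I_m) (x : O m.+1) (y : O n.+1) (z : O r.+1) :
  same (op_circS ord_max (op_circS (widen_ord (leqnSn m) i) x y) z)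
       (op_circS (widen_ord (leqnSn (m + r)) (lshift r i)) (op_circS ord_max x z) y).
Proof.
apply: same_trans (same_cast _ _) _; apply: same_trans (same_sym (same_cast _ _)).
have iN : widen_ord (leqnSn m) i != ord_max by rewrite -val_eqE /= neq_ltn ltn_ord.
apply: (same_circ_par iN); try exact: same_cast.
  move=> s t st; rewrite -val_eqE /= st.
  have j0 : (0 < if (ord_max : 'I_m.+1) == widen_ord (leqnSn m) i then n.+1 else 1)%N.
    by case: ifP.
  pose p (j : 'I_m.+1) := if j == widen_ord (leqnSn m) i then n.+1 else 1%N.
  have pE : (m + n)%N = @tagnat.Rank _ p ord_max (Ordinal j0) :> nat.
    rewrite tagnat.RankEsum addn0.
    have := sum_plug n.+1 (widen_ord (leqnSn m) i); rewrite (bigD1 ord_max) //=.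
    rewrite (negPf (_ : ord_max != _)) 1?eq_sym //= addnS add1n => -[<-].
    by apply: eq_bigl => j; rewrite -val_eqE ltn_neqAle -ltnS ltn_ord andbT.
  rewrite pE -[t in LHS]tagnat.sig2K tagnat.eq_Rank /=.
  case: eqP => //= tm; move: (tagnat.sig2 t) => /= u.
  have p1 : p (tagnat.sig1 t) = 1%N by rewrite tm /p eq_sym (negPf iN).
  by have := leq_trans (ltn_ord u) (eq_leq p1); rewrite ltnS leqn0.
move=> s t st; rewrite -val_eqE /= st.
pose p (j : 'I_m.+1) := if j == ord_max then r.+1 else 1%N.
have pi : p (widen_ord (leqnSn m) i) = 1%N by rewrite /p (negPf iN).
have j0 : (0 < p (widen_ord (leqnSn m) i))%N by rewrite pi.
have -> : nat_of_ord i = @tagnat.Rank _ p _ (Ordinal j0) :> nat.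
  by rewrite Rank_plug /= ?addn0 // ltnW.
rewrite -[t in LHS]tagnat.sig2K tagnat.eq_Rank /=.
case: eqP => //= tm; move: (tagnat.sig2 t) => /= u.
have p1 : p (tagnat.sig1 t) = 1%N by rewrite tm.
by have := leq_trans (ltn_ord u) (eq_leq p1); rewrite ltnS leqn0.
Qed.

Lemma op_circS_assoc m n r (j : 'I_n.+1) (x : O m.+1) (y : O n.+1) (z : O r.+1)
    (p : 'I_(m + n).+1) :
  p = (m + j)%N :> nat ->
  same (op_circS ord_max x (op_circS j y z)) (op_circS p (op_circS ord_max x y) z).
Proof.
move=> pE; apply: same_trans (same_cast _ _) _.
apply: same_trans (same_sym (same_cast _ _)).
have E : same (op_circ ord_max x (op_circS j y z)) (op_circ ord_max x (op_circ j y z)).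
  apply: same_trans (same_circ _ _ _) _; apply: same_sym.
  apply: same_trans (same_circ _ _ _) _; apply: same_comp => // a b /val_inj ->.
  by case: (b == ord_max) => //=; apply: same_sym; apply: same_cast.
apply: same_trans E _; apply: same_circA => //.
exact: same_cast.
Qed.

Lemma op_circS_unitl n (y : O n.+1) :
  same (op_circS (ord_max : 'I_1) (op_unit O) y) y.
Proof.
by apply: same_trans (same_circS _ _ _) _; apply: same_comp1; rewrite ord1.
Qed.

Lemma op_circS_unitr m (x : O m.+1) : same (op_circS ord_max x (op_unit O)) x.
Proof.
apply: same_trans (same_circS _ _ _) _; apply: same_compr1 => i.
exact: same_plug1.
Qed.

Lemma op_cast_linear m n (e : m = n) : linear (op_cast e : O m -> O n).
Proof. by case: n / e. Qed.

Lemma op_circS_linearl m n (i : 'I_m.+1) (y : O n.+1) :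
  linear (fun x : O m.+1 => op_circS i x y).
Proof. by move=> a x x'; rewrite /op_circS /op_circ op_comp_linearl !op_cast_linear. Qed.

Lemma op_circS_linearr m n (i : 'I_m.+1) (x : O m.+1) :
  linear (fun y : O n.+1 => op_circS i x y).
Proof.
move=> a y y'; rewrite /op_circS /op_circ -!op_cast_linear; congr op_cast.
congr op_cast.
pose p (j : 'I_m.+1) := if j == i then n.+1 else 1%N.
have pi : p i = n.+1 by rewrite /p eqxx.
have plugE (z : O n.+1) : (fun j => plug (j == i) z) =
    dfwith (fun j => plug (j == i) (0 : O n.+1)) (op_cast (esym pi) z)
    :> (forall j, O (p j)).
  apply: functional_extensionality_dep => j; apply: same_eq.
  case: dfwithP => [|{}j ij].
    apply: same_sym; apply: same_trans (same_cast _ _) _; apply: same_sym.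
    exact: same_plug z (eqxx i).
  have ji : (j == i) = false by rewrite eq_sym (negPf ij).
  apply: same_trans (same_plug z ji) _; apply: same_sym.
  exact: same_plug 0 ji.
by rewrite (plugE (a *: y + y')) (plugE y) (plugE y') op_cast_linear op_comp_linearr.
Qed.
End PartialCompositionTheory.

(* Unital associative algebras; 1 = 0 is allowed, unlike in algType, because
   U_O(A) is zero when O is. *)
Record ualgebra (K : fieldType) := UAlgebra {
  ualg_space :> lmodType K;
  umul : ualg_space -> ualg_space -> ualg_space;
  uone : ualg_space;
  umul_linearl : forall v, linear (umul^~ v);
  umul_linearr : forall u, linear (umul u);
  umulA : associative umul;
  umul1l : left_id uone umul;
  umul1r : right_id uone umul
}.

Section EnvelopingAlgebra.
Variables (K : fieldType) (O : operad K) (A : op_algebra O).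
Local Notation U := (env A).

Lemma envZ_linearl m (a : A ^ m) : linear (fun x : O m.+1 => envZ x a : U).
Proof. by move=> k x x'; rewrite /envZ (lproj_rel (env_rel_linl _ _ _ _)) linearP. Qed.

Lemma envZ_linearr m (x : O m.+1) (a : A ^ m) i :
  linear (fun b => envZ x (upd a i b) : U).
Proof. by move=> k b b'; rewrite /envZ (lproj_rel (env_rel_linr _ _ _ _ _ _)) linearP. Qed.

Lemma envZ_perm m (s : 'S_m) (x : O m.+1) (a : A ^ m) :
  envZ (op_act (lift_last s) x) a = envZ x [ffun i => a (s i)].
Proof. exact/lproj_rel/env_rel_perm. Qed.

Lemma envZ_comp m n (i : 'I_m) (x : O m.+1) (y : O n.+1) (a : A ^ (m + n)) :
  envZ (op_circS (widen_ord (leqnSn m) i) x y) a = envZ x (ins_op i y a).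
Proof. exact/lproj_rel/env_rel_comp. Qed.

Lemma envZ_same m m' (x : O m.+1) (x' : O m'.+1) (a : A ^ m) (a' : A ^ m') :
  same x x' -> (forall (i : 'I_m) (j : 'I_m'), i = j :> nat -> a i = a' j) ->
  envZ x a = envZ x' a'.
Proof.
move=> xx aa; have [e] := same_arity xx; case: m' / e x' a' xx aa.
move=> x' a' /same_eq -> aa; congr envZ; apply/ffunP => i; exact: aa.
Qed.

Lemma env_ind (P : U -> Prop) :
  P 0 ->
  (forall k m (x : O m.+1) (a : A ^ m) u, P u -> P (k *: envZ x a + u)) ->
  forall u, P u.
Proof.
move=> P0 PD u; rewrite -[u]lreprK.
apply: (freeg_gen (P := fun D => P (lproj _ D))); first by rewrite linear0.
by move=> k [m [x a]] D IH; rewrite linearP; apply: PD.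
Qed.

Lemma env_ext (V : lmodType K) (f g : U -> V) : linear f -> linear g ->
  (forall m (x : O m.+1) (a : A ^ m), f (envZ x a) = g (envZ x a)) -> f =1 g.
Proof.
move=> fL gL fg; apply: env_ind => [|k m x a u IH].
  by rewrite (linear_fun0 fL) (linear_fun0 gL).
by rewrite fL gL fg IH.
Qed.

Section Lift.
Variables (V : lmodType K) (f : forall m, O m.+1 -> A ^ m -> V).

Definition env_lift (u : U) : V :=
  llift (fglift (fun g : env_gen A => f (tagged g).1 (tagged g).2)) u.

Hypothesis f_linl : forall m (a : A ^ m), linear (fun x => f x a).
Hypothesis f_linr : forall m (x : O m.+1) (a : A ^ m) i,
  linear (fun b => f x (upd a i b)).
Hypothesis f_perm : forall m (s : 'S_m) (x : O m.+1) (a : A ^ m),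
  f (op_act (lift_last s) x) a = f x [ffun i => a (s i)].
Hypothesis f_comp : forall m n (i : 'I_m) (x : O m.+1) (y : O n.+1)
    (a : A ^ (m + n)),
  f (op_circS (widen_ord (leqnSn m) i) x y) a = f x (ins_op i y a).

Let f_rel x y : env_rel x y ->
  fglift (fun g : env_gen A => f (tagged g).1 (tagged g).2) x =
  fglift (fun g : env_gen A => f (tagged g).1 (tagged g).2) y.
Proof.
case=> *; rewrite ?linearP /= !fglift_gen /=.
- exact: f_linl.
- exact: f_linr.
- exact: f_perm.
- exact: f_comp.
Qed.

Lemma env_liftE m (x : O m.+1) (a : A ^ m) : env_lift (envZ x a) = f x a.
Proof. by rewrite /env_lift /envZ lliftE //= fglift_gen. Qed.

Lemma env_lift_linear : linear env_lift.
Proof. exact: llift_is_linear. Qed.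
End Lift.

Lemma ffcat_lshift m n (a : A ^ m) (b : A ^ n) i : ffcat a b (lshift n i) = a i.
Proof. by rewrite ffunE (unsplitK (inl i)). Qed.

Lemma ffcat_rshift m n (a : A ^ m) (b : A ^ n) i : ffcat a b (rshift m i) = b i.
Proof. by rewrite ffunE (unsplitK (inr i)). Qed.

Definition env_mulZ l (y : O l.+1) (b : A ^ l) : U -> U :=
  env_lift (fun m x a => envZ (op_circS ord_max x y) (ffcat a b)).

Definition env_mul (u v : U) : U := env_lift (fun l y b => env_mulZ y b u) v.

Definition env_one : U := envZ (op_unit O) [ffun i : 'I_0 => 0].

Lemma ffcatl m n (a : A ^ m) (b : A ^ n) (k : 'I_(m + n)) (i : 'I_m) :
  k = i :> nat -> ffcat a b k = a i.
Proof. by move=> ki; rewrite -(ffcat_lshift a b); congr (ffcat a b _); apply: ord_inj. Qed.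

Lemma ffcatr m n (a : A ^ m) (b : A ^ n) (k : 'I_(m + n)) (j : 'I_n) :
  k = (m + j)%N :> nat -> ffcat a b k = b j.
Proof. by move=> ki; rewrite -(ffcat_rshift a b); congr (ffcat a b _); apply: ord_inj. Qed.

Lemma ffcat_updl m n (a : A ^ m) (b : A ^ n) i x :
  ffcat (upd a i x) b = upd (ffcat a b) (lshift n i) x.
Proof.
apply/ffunP => k; case: (split_ordP k) => j ->; rewrite [RHS]ffunE.
  by rewrite !ffcat_lshift ffunE eq_lshift.
by rewrite !ffcat_rshift eq_rlshift.
Qed.

Lemma ffcat_updr m n (a : A ^ m) (b : A ^ n) i x :
  ffcat a (upd b i x) = upd (ffcat a b) (rshift m i) x.
Proof.
apply/ffunP => k; case: (split_ordP k) => j ->; rewrite [RHS]ffunE.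
  by rewrite !ffcat_lshift eq_lrshift.
by rewrite !ffcat_rshift ffunE eq_rshift.
Qed.

Lemma ffcat_insl m n r (i : 'I_m) (y : O n.+1) (a : A ^ (m + n)) (b : A ^ r)
    (c : A ^ (m + r + n)) :
  (forall (k : 'I_(m + r + n)) (l : 'I_(m + n + r)), k = l :> nat ->
     c k = ffcat a b l) ->
  ins_op (lshift r i) y c = ffcat (ins_op i y a) b.
Proof.
move=> cE.
have ca (k : 'I_(m + r + n)) (l : 'I_(m + n)) : k = l :> nat -> c k = a l.
  by move=> kl; rewrite (cE k (lshift r l)) // ffcat_lshift.
have cb (k : 'I_(m + r + n)) (l : 'I_r) : k = (m + n + l)%N :> nat -> c k = b l.
  by move=> kl; rewrite (cE k (rshift (m + n) l)) // ffcat_rshift.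
apply/ffunP => k; case: (split_ordP k) => j ->; rewrite ffunE.
  rewrite ffcat_lshift [RHS]ffunE eq_lshift /=; case: ifP => _; first exact: ca.
  case: ifP => _; last exact: ca.
  by congr opalg_act; apply/ffunP => l; rewrite !ffunE; apply: ca.
rewrite ffcat_rshift eq_rlshift /= ltnNge (leq_trans (ltnW (ltn_ord i))) ?leq_addr //=.
by apply: cb; rewrite /= addnA [(n + m)%N]addnC.
Qed.

Lemma ffcat_insr m n r (j : 'I_n) (z : O r.+1) (a : A ^ m) (b : A ^ (n + r))
    (c : A ^ (m + n + r)) :
  (forall (k : 'I_(m + n + r)) (l : 'I_(m + (n + r))), k = l :> nat ->
     c k = ffcat a b l) ->
  ins_op (rshift m j) z c = ffcat a (ins_op j z b).
Proof.
move=> cE.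
have ca (k : 'I_(m + n + r)) (l : 'I_m) : k = l :> nat -> c k = a l.
  by move=> kl; rewrite (cE k (lshift (n + r) l)) // ffcat_lshift.
have cb (k : 'I_(m + n + r)) (l : 'I_(n + r)) : k = (m + l)%N :> nat -> c k = b l.
  by move=> kl; rewrite (cE k (rshift m l)) // ffcat_rshift.
apply/ffunP => k; case: (split_ordP k) => i ->; rewrite ffunE.
  by rewrite ffcat_lshift /= ltn_addr //; apply: ca.
rewrite ffcat_rshift [RHS]ffunE eq_rshift /= ltn_add2l.
case: ifP => _; first exact: cb.
case: ifP => _; last by apply: cb; rewrite /= addnCA.
by congr opalg_act; apply/ffunP => l; rewrite !ffunE; apply: cb; rewrite /= addnA.
Qed.

Section MulZ.
Variables (l : nat) (y : O l.+1) (b : A ^ l).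
Let f m (x : O m.+1) (a : A ^ m) : U := envZ (op_circS ord_max x y) (ffcat a b).

Let f_linl m (a : A ^ m) : linear (fun x => f x a).
Proof. by move=> k x x'; rewrite /f op_circS_linearl envZ_linearl. Qed.

Let f_linr m (x : O m.+1) (a : A ^ m) i : linear (fun c => f x (upd a i c)).
Proof. by move=> k c c'; rewrite /f !ffcat_updl envZ_linearr. Qed.

Let f_perm m (s : 'S_m) (x : O m.+1) (a : A ^ m) :
  f (op_act (lift_last s) x) a = f x [ffun i => a (s i)].
Proof.
rewrite /f op_circS_actl envZ_perm; congr envZ; apply/ffunP => k; rewrite ffunE.
case: (split_ordP k) => i ->.
  by rewrite sum_perm_lshift !ffcat_lshift ffunE.
by rewrite sum_perm_rshift !ffcat_rshift perm1.
Qed.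

Let f_comp m n (i : 'I_m) (x : O m.+1) (z : O n.+1) (a : A ^ (m + n)) :
  f (op_circS (widen_ord (leqnSn m) i) x z) a = f x (ins_op i z a).
Proof.
have e : (m + l + n = m + n + l)%N by rewrite addnAC.
pose c : A ^ (m + l + n) := [ffun k => ffcat a b (cast_ord e k)].
have cE (k : 'I_(m + l + n)) (k' : 'I_(m + n + l)) : k = k' :> nat ->
    c k = ffcat a b k'.
  by move=> kk; rewrite ffunE; congr (ffcat a b _); apply: ord_inj.
rewrite /f -(ffcat_insl i z cE) -envZ_comp.
by apply: envZ_same => [|k k' kk]; [exact: op_circS_par | exact/esym/cE].
Qed.

Lemma env_mulZE m (x : O m.+1) (a : A ^ m) :
  env_mulZ y b (envZ x a) = envZ (op_circS ord_max x y) (ffcat a b).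
Proof. exact: env_liftE f_linl f_linr f_perm f_comp m x a. Qed.

Lemma env_mulZ_linear : linear (env_mulZ y b).
Proof. exact: env_lift_linear f_linl f_linr f_perm f_comp. Qed.
End MulZ.

Lemma linear_comb (V W : lmodType K) (k : K) (f g : V -> W) :
  linear f -> linear g -> linear (fun u => k *: f u + g u).
Proof.
move=> fL gL h u v; rewrite fL gL !scalerDr !scalerA (mulrC k) -!addrA.
by congr (_ + _); rewrite addrCA.
Qed.

Section Mul.
Variable u : U.
Let f l (y : O l.+1) (b : A ^ l) : U := env_mulZ y b u.

Let f_linl l (b : A ^ l) : linear (fun y => f y b).
Proof.
move=> k y y'; rewrite /f.
apply: (env_ext (f := env_mulZ (k *: y + y') b)
                (g := fun u => k *: env_mulZ y b u + env_mulZ y' b u)).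
- exact: env_mulZ_linear.
- by apply: linear_comb; apply: env_mulZ_linear.
by move=> m x a; rewrite !env_mulZE op_circS_linearr envZ_linearl.
Qed.

Let f_linr l (y : O l.+1) (b : A ^ l) i : linear (fun c => f y (upd b i c)).
Proof.
move=> k c c'; rewrite /f.
apply: (env_ext (f := env_mulZ y (upd b i (k *: c + c')))
   (g := fun u => k *: env_mulZ y (upd b i c) u + env_mulZ y (upd b i c') u)).
- exact: env_mulZ_linear.
- by apply: linear_comb; apply: env_mulZ_linear.
by move=> m x a; rewrite !env_mulZE !ffcat_updr envZ_linearr.
Qed.

Let f_perm l (s : 'S_l) (y : O l.+1) (b : A ^ l) :
  f (op_act (lift_last s) y) b = f y [ffun i => b (s i)].
Proof.
apply: (env_ext (f := env_mulZ (op_act (lift_last s) y) b)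
                (g := env_mulZ y [ffun i => b (s i)])).
- exact: env_mulZ_linear.
- exact: env_mulZ_linear.
move=> m x a; rewrite !env_mulZE op_circS_actr envZ_perm.
congr envZ; apply/ffunP => k; rewrite ffunE.
case: (split_ordP k) => i ->.
  by rewrite sum_perm_lshift !ffcat_lshift perm1.
by rewrite sum_perm_rshift !ffcat_rshift ffunE.
Qed.

Let f_comp l n (i : 'I_l) (y : O l.+1) (z : O n.+1) (b : A ^ (l + n)) :
  f (op_circS (widen_ord (leqnSn l) i) y z) b = f y (ins_op i z b).
Proof.
apply: (env_ext (f := env_mulZ (op_circS (widen_ord (leqnSn l) i) y z) b)
                (g := env_mulZ y (ins_op i z b))).
- exact: env_mulZ_linear.
- exact: env_mulZ_linear.
move=> m x a; rewrite !env_mulZE.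
have e : (m + l + n = m + (l + n))%N by rewrite addnA.
pose c : A ^ (m + l + n) := [ffun k => ffcat a b (cast_ord e k)].
have cE (k : 'I_(m + l + n)) (k' : 'I_(m + (l + n))) : k = k' :> nat ->
    c k = ffcat a b k'.
  by move=> kk; rewrite ffunE; congr (ffcat a b _); apply: ord_inj.
rewrite -(ffcat_insr i z cE) -envZ_comp.
apply: envZ_same => [|k k' kk]; last exact/esym/cE.
exact: op_circS_assoc.
Qed.

Lemma env_mulEr l (y : O l.+1) (b : A ^ l) : env_mul u (envZ y b) = env_mulZ y b u.
Proof. exact: env_liftE f_linl f_linr f_perm f_comp l y b. Qed.

Lemma env_mul_linearr : linear (env_mul u).
Proof. exact: env_lift_linear f_linl f_linr f_perm f_comp. Qed.
End Mul.

Lemma env_mulE m l (x : O m.+1) (a : A ^ m) (y : O l.+1) (b : A ^ l) :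
  env_mul (envZ x a) (envZ y b) = envZ (op_circS ord_max x y) (ffcat a b).
Proof. by rewrite env_mulEr env_mulZE. Qed.

Lemma env_mul_linearl v : linear (env_mul^~ v).
Proof.
move=> k u u'.
apply: (env_ext (f := env_mul (k *: u + u'))
                (g := fun v => k *: env_mul u v + env_mul u' v)).
- exact: env_mul_linearr.
- by apply: linear_comb; apply: env_mul_linearr.
by move=> m y b; rewrite !env_mulEr env_mulZ_linear.
Qed.

Lemma env_mulA : associative env_mul.
Proof.
move=> u v w; move: u.
apply: (env_ext (f := fun u => env_mul u (env_mul v w))
                (g := fun u => env_mul (env_mul u v) w)).
- exact: env_mul_linearl.
- by move=> k u u'; rewrite !env_mul_linearl.
move=> m x a; move: v.
apply: (env_ext (f := fun v => env_mul (envZ x a) (env_mul v w))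
                (g := fun v => env_mul (env_mul (envZ x a) v) w)).
- by move=> k u u'; rewrite env_mul_linearl env_mul_linearr.
- by move=> k u u'; rewrite env_mul_linearr env_mul_linearl.
move=> n y b; move: w.
apply: (env_ext (f := fun w => env_mul (envZ x a) (env_mul (envZ y b) w))
                (g := env_mul (env_mul (envZ x a) (envZ y b)))).
- by move=> k u u'; rewrite !env_mul_linearr.
- exact: env_mul_linearr.
move=> r z c; rewrite !env_mulE; apply: envZ_same; first exact: op_circS_assoc.
move=> i j ij.
case: (split_ordP j) ij => {}j ->; last first.
  rewrite ffcat_rshift /= => ij.
  by rewrite (ffcatr _ _ (j := rshift n j)) ?ij /= ?addnA // ffcat_rshift.
rewrite ffcat_lshift; case: (split_ordP j) => {}j -> /= ij.
  by rewrite ffcat_lshift (ffcatl _ _ ij).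
rewrite ffcat_rshift (ffcatr _ _ (j := lshift r j)) ?ij //.
exact: ffcat_lshift.
Qed.

Lemma env_mul1l : left_id env_one env_mul.
Proof.
move=> v.
apply: (env_ext (f := env_mul env_one) (g := id)) => //.
  exact: env_mul_linearr.
move=> n y b; rewrite env_mulE; apply: envZ_same; first exact: op_circS_unitl.
by move=> i j ij; rewrite (ffcatr _ _ (j := j)).
Qed.

Lemma env_mul1r : right_id env_one env_mul.
Proof.
move=> u.
apply: (env_ext (f := env_mul^~ env_one) (g := id)) => //.
  exact: env_mul_linearl.
move=> n y b; rewrite env_mulE; apply: envZ_same; first exact: op_circS_unitr.
by move=> i j ij; rewrite (ffcatl _ _ ij).
Qed.

Definition env_alg : ualgebra K :=
  UAlgebra env_mul_linearl env_mul_linearr env_mulA env_mul1l env_mul1r.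
End EnvelopingAlgebra.

(* C -> Hom_K(A, B) is a function phi : C -> {linear A -> B} that is linear in
   the sense of the following predicate. *)
Definition hom_linear (K : fieldType) (C V W : lmodType K)
    (phi : C -> {linear V -> W}) : Prop :=
  forall v, linear (fun c => phi c v).

(* For n = 0 the second clause says phi c (x ()) = counit c *: x (). *)
Definition op_measuring (K : fieldType) (O : operad K) (A B : op_algebra O)
    (C : coalgebra K) (phi : C -> {linear A -> B}) : Prop :=
  hom_linear phi /\
  forall (c : C) (n : nat) (x : O n) (a : A ^ n),
    phi c (opalg_act x a) =
    sweedler_sum (fun t : n.-tuple C =>
      opalg_act x [ffun i => phi (tnth t i) (a i)]) c.

Definition alg_measuring (K : fieldType) (A B : ualgebra K) (C : coalgebra K)
    (phi : C -> {linear A -> B}) : Prop :=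
  [/\ hom_linear phi,
      forall (c : C) (a a' : A),
        phi c (umul a a') =
        \sum_(p <- sweedler c) umul (phi p.1 a) (phi p.2 a')
    & forall c : C, phi c (uone A) = counit C c *: uone B].

(* Phi is U_O(phi). *)
Definition env_induced (K : fieldType) (O : operad K) (A B : op_algebra O)
    (C : coalgebra K) (phi : C -> {linear A -> B})
    (Phi : C -> {linear env_alg A -> env_alg B}) : Prop :=
  hom_linear Phi /\
  forall (c : C) (m : nat) (x : O m.+1) (a : A ^ m),
    Phi c (envZ x a) =
    sweedler_sum (fun t : m.-tuple C =>
      envZ x [ffun i => phi (tnth t i) (a i)]) c.

(* Main.v *)
Require Import Defs.
From mathcomp Require Import all_boot all_algebra.
From HB Require Import structures.
From mathcomp Require Import all_fingroup boolp zify.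

(** Write [S_n f c] for the sum of [f (c_1, ..., c_n)] over the (n-1)-fold
    coproduct of [c], with [S_0 f c = counit c *: f ()].  When [f] is multilinear
    these sums obey three laws, and each of them is one compatibility of the
    formula [c, Z(x; a) |-> S_m (Z(x; phi(c_1) a_1, ..., phi(c_m) a_m)) c] with
    the structure of the enveloping algebra.

    - Coassociativity: a sum over [m + n] factors splits as a sum over the first
      [m] and the last [n] of them, taken at the two halves of the coproduct of
      [c] ([ssum_cat]; the counit laws are the cases [m = 0] and [n = 0]).  This
      is multiplicativity, because the product of two generators concatenates
      their arguments ([env_mapM]).
    - Substitution: expanding the [k]-th factor again into [n] factors gives the
      sum over [k + n + l] factors ([ssum_subst]).  Together with the measuring
      axiom for [phi] this is the relation that composes an operation into the
      [i]-th argument ([env_ssum_comp]).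
    - Symmetry: if [C] is cocommutative, [S_n f] does not change when the
      factors are permuted ([ssum_perm]).  This is the equivariance relation
      ([env_ssum_perm]), and the only place where cocommutativity enters.

    Hence the formula descends to the quotient defining the enveloping algebra.
    It is the unique such map since the [Z(x; a)] span, and the unit, having no
    arguments, is mapped to [counit c] times the unit by the case [n = 0].

    The tuples of factors are handled as plain sequences, so that concatenation
    and substitution need no transport along equalities of lengths. *)

Set Implicit Arguments.
Unset Strict Implicit.
Unset Printing Implicit Defensive.

Import GRing.Theory.
Local Open Scope ring_scope.

(** * Sums and linear functions *)

Section LinearFunctions.
Variables (K : fieldType) (V W : lmodType K).

Lemma linear_fun_sum (I : Type) (r : seq I) (F : I -> V) (f : V -> W) :
  linear f -> f (\sum_(i <- r) F i) = \sum_(i <- r) f (F i).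
Proof.
move=> fL; elim: r => [|i r IH]; first by rewrite !big_nil linear_fun0.
by rewrite !big_cons -[F i]scale1r fL !scale1r IH.
Qed.

Lemma sum_linear_fun (I : Type) (r : seq I) (F : I -> V -> W) :
  (forall i, linear (F i)) -> linear (fun v => \sum_(i <- r) F i v).
Proof.
move=> FL a u v; rewrite scaler_sumr -big_split /=.
by apply: eq_bigr => i _; rewrite FL.
Qed.
End LinearFunctions.

(** * Bilinear and trilinear sums over one coproduct *)

Section SweedlerCalculus.
Variables (K : fieldType) (C : coalgebra K).

(** The chosen decomposition of a tensor is not additive in the tensor, but a
    bilinear sum only depends on the tensor, so compatible decompositions of the
    three tensors can be used instead. *)
Lemma tens_seq_linear (V W X : lmodType K) (g : V -> W -> X) :
  (forall y, linear (g^~ y)) -> (forall x, linear (g x)) ->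
  linear (fun t => \sum_(p <- tens_seq t) g p.1 p.2).
Proof.
move=> gl gr a t t'.
rewrite (tens_seq_bilin gl gr
  (s := [seq (a *: p.1, p.2) | p <- tens_seq t] ++ tens_seq t')).
  rewrite big_cat big_map scaler_sumr /=; congr (_ + _).
  by apply: eq_bigr => p _; rewrite (linear_funZ _ _ (gl _)).
rewrite big_cat big_map tens_seqE -[in LHS](tens_seqE t) scaler_sumr /=.
by congr (_ + _); apply: eq_bigr => p _; rewrite (linear_funZ _ _ (@tens_linl _ _ _ _)).
Qed.

Lemma sweedler_linear (V : lmodType K) (g : C -> C -> V) :
  (forall y, linear (g^~ y)) -> (forall x, linear (g x)) ->
  linear (fun c => \sum_(p <- sweedler c) g p.1 p.2).
Proof.
by move=> gl gr a c d; rewrite /sweedler linearP (tens_seq_linear gl gr).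
Qed.

(** Coassociativity is an equation in C (x) (C (x) C); it becomes an identity of
    sums by pairing it with the bilinear function G induced by h. *)
Lemma sweedlerA (V : lmodType K) (h : C -> C -> C -> V) (c : C) :
  (forall y z, linear (fun x => h x y z)) ->
  (forall x z, linear (fun y => h x y z)) ->
  (forall x y, linear (h x y)) ->
  \sum_(p <- sweedler c) \sum_(q <- sweedler p.2) h p.1 q.1 q.2 =
  \sum_(p <- sweedler c) \sum_(q <- sweedler p.1) h q.1 q.2 p.2.
Proof.
move=> h1 h2 h3.
pose G x (t : tensor C C) := \sum_(q <- tens_seq t) h x q.1 q.2.
have Gl t : linear (G^~ t) by apply: sum_linear_fun => q.
have Gr x : linear (G x).
  by apply: (tens_seq_linear (g := h x)) => y; [exact: h2 | exact: h3].
have Gt x y z : G x (tens y z) = h x y z.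
  by rewrite /G (tens_seq_bilin (h2 x) (h3 x) (s := [:: (y, z)])) ?big_seq1.
set s1 := [seq (p.1, coproduct C p.2) | p <- sweedler c].
set s2 := flatten [seq [seq (q.1, tens q.2 p.2) | q <- sweedler p.1]
                  | p <- sweedler c].
have e1 := tens_seq_bilin Gl Gr (t := _) (s := s1) erefl.
have e2 : \sum_(p <- s1) tens p.1 p.2 = \sum_(p <- s2) tens p.1 p.2.
  rewrite big_map coproductA big_flatten big_map.
  by apply: eq_bigr => p _; rewrite big_map.
rewrite {}e2 (tens_seq_bilin Gl Gr (s := s2) erefl) in e1.
move: e1; rewrite big_map big_flatten big_map => e1.
rewrite -[LHS]e1; apply: eq_bigr => p _; rewrite big_map.
by apply: eq_bigr => q _; exact: Gt.
Qed.

Lemma sweedlerC (V : lmodType K) (g : C -> C -> V) (c : C) :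
  cocommutative C -> (forall y, linear (g^~ y)) -> (forall x, linear (g x)) ->
  \sum_(p <- sweedler c) g p.1 p.2 = \sum_(p <- sweedler c) g p.2 p.1.
Proof.
move=> CC gl gr.
rewrite (tens_seq_bilin gl gr (s := [seq (p.2, p.1) | p <- sweedler c])).
  by rewrite big_map.
by rewrite big_map -CC.
Qed.
End SweedlerCalculus.

(** * Sums over the iterated coproduct *)

Section IteratedSweedler.
Variables (K : fieldType) (C : coalgebra K).

(** Only the values of f on sequences of size n matter; f may be arbitrary
    elsewhere. *)
Definition multilinear (V : lmodType K) (n : nat) (f : seq C -> V) : Prop :=
  forall s1 s2, (size s1 + size s2).+1 = n -> linear (fun c => f (s1 ++ c :: s2)).

Definition ssum (V : lmodType K) (n : nat) (f : seq C -> V) (c : C) : V :=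
  sweedler_sum (fun t : n.-tuple C => f t) c.

Section Multilinear.
Variables (V : lmodType K).
Implicit Types f g : seq C -> V.

Lemma multilinear_head n f s :
  multilinear n.+1 f -> size s = n -> linear (fun c => f (c :: s)).
Proof. by move=> fM sn; apply: (fM [::]); rewrite add0n sn. Qed.

Lemma multilinear_prefix m n f s : multilinear (m + n) f -> size s = m ->
  multilinear n (fun t => f (s ++ t)).
Proof.
move=> fM sm s1 s2 s12 a c d; rewrite !catA; apply: fM.
by rewrite size_cat -addnA -addnS s12 sm.
Qed.

Lemma multilinear_suffix m n f t : multilinear (m + n) f -> size t = n ->
  multilinear m (fun s => f (s ++ t)).
Proof.
move=> fM tn s1 s2 s12 a c d; rewrite -!catA; apply: fM.
by rewrite size_cat addnA -addSn s12 tn.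
Qed.

Lemma multilinear_cons n f c :
  multilinear n.+1 f -> multilinear n (fun s => f (c :: s)).
Proof. by move=> fM; apply: (multilinear_prefix (m := 1) (s := [:: c])). Qed.
End Multilinear.

Lemma eq_ssum (V : lmodType K) n (f g : seq C -> V) c :
  (forall s, size s = n -> f s = g s) -> ssum n f c = ssum n g c.
Proof.
case: n => [|n] fg; rewrite /ssum /=; first by rewrite fg.
by apply: eq_bigr => t _; rewrite fg ?size_tuple.
Qed.

Lemma linear_ssum (V W : lmodType K) n (f : seq C -> V) (h : V -> W) c :
  linear h -> h (ssum n f c) = ssum n (fun s => h (f s)) c.
Proof.
move=> hL; case: n => [|n]; rewrite /ssum /=; first exact: linear_funZ.
exact: linear_fun_sum.
Qed.

Lemma ssum_param_linear (U V : lmodType K) n (F : U -> seq C -> V) c :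
  (forall s, size s = n -> linear (fun u => F u s)) ->
  linear (fun u => ssum n (F u) c).
Proof.
case: n => [|n] FL; rewrite /ssum /=.
  by move=> a u v; rewrite FL // scalerDr !scalerA mulrC.
by apply: sum_linear_fun => t; apply: FL; exact: size_tuple.
Qed.

Lemma ssum_exchange (V : lmodType K) m n (f : seq C -> seq C -> V) c d :
  ssum m (fun s => ssum n (f s) d) c = ssum n (fun t => ssum m (f^~ t) c) d.
Proof.
rewrite /ssum; case: m n => [|m] [|n] /=.
- by rewrite !scalerA mulrC.
- by rewrite scaler_sumr.
- by rewrite scaler_sumr.
exact: exchange_big.
Qed.

Section Laws.
Variables (V : lmodType K).
Implicit Types f g : seq C -> V.

Lemma ssum0 f c : ssum 0 f c = counit C c *: f [::].
Proof. by []. Qed.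

(** The recursion defining the iterated coproduct starts at one factor; the
    counit law extends it to n = 0, which makes uniform inductions possible. *)
Lemma ssumS n f c : multilinear n.+1 f ->
  ssum n.+1 f c = \sum_(p <- sweedler c) ssum n (fun s => f (p.1 :: s)) p.2.
Proof.
case: n => [|n] fM; rewrite /ssum /=; last first.
  rewrite big_flatten big_map; apply: eq_bigr => p _.
  by rewrite big_map.
have fL : linear (fun c => f [:: c]) by exact: (multilinear_head fM).
rewrite big_seq1 /= -[in LHS](counitr c) (linear_fun_sum _ _ fL).
by apply: eq_bigr => p _; rewrite (linear_funZ _ _ fL).
Qed.

Lemma ssum_linear n f : multilinear n f -> linear (ssum n f).
Proof.
elim: n f => [|n IH] f fM a c d.
  by rewrite !ssum0 linearP scalerDl scalerA.
rewrite !ssumS //; move: a c d.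
apply: (sweedler_linear (g := fun x y => ssum n (fun s => f (x :: s)) y)) => x.
  by apply: ssum_param_linear => s; apply: multilinear_head.
exact/IH/multilinear_cons.
Qed.

Lemma ssum1 f c : multilinear 1 f -> ssum 1 f c = f [:: c].
Proof. by move=> fM; rewrite /ssum /= big_seq1. Qed.

(** Induction on m peels off the first factor of c, which yields a coproduct of
    the second half; coassociativity moves it to the first half. *)
Lemma ssum_cat m n f c : multilinear (m + n) f ->
  ssum (m + n) f c =
  \sum_(p <- sweedler c) ssum m (fun s => ssum n (fun t => f (s ++ t)) p.2) p.1.
Proof.
elim: m f c => [|m IH] f c fM.
  rewrite -[in LHS](counitl c) (linear_fun_sum _ _ (ssum_linear fM)).
  by apply: eq_bigr => p _; rewrite (linear_funZ _ _ (ssum_linear fM)).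
rewrite addSn in fM *; rewrite ssumS //.
under eq_bigr => p _ do rewrite (IH _ _ (multilinear_cons _ fM)).
rewrite (sweedlerA
  (h := fun x y z => ssum m (fun s => ssum n (fun t => f (x :: s ++ t)) z) y)).
- apply: eq_bigr => p _; apply/esym/(ssumS (n := m)) => s1 s2 s12.
  apply: ssum_param_linear => t tn.
  by apply: (multilinear_suffix (m := m.+1) fM tn).
- move=> y z; apply: ssum_param_linear => s sm; apply: ssum_param_linear => t tn.
  by apply: (multilinear_head (s := s ++ t) fM); rewrite size_cat sm tn.
- move=> x z; apply: ssum_linear => s1 s2 s12; apply: ssum_param_linear => t tn.
  exact: (multilinear_suffix (multilinear_cons x fM) tn).
move=> x y; apply: ssum_param_linear => s sm; apply: ssum_linear.
exact: (multilinear_prefix (multilinear_cons x fM)).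
Qed.
End Laws.

(** Recognizes as multilinear those expressions that treat a prefix and the rest
    of a sequence separately, such as rotations. *)
Lemma multilinear_split (V : lmodType K) m n (F : seq C -> seq C -> V) :
  (forall t, size t = n -> multilinear m (F^~ t)) ->
  (forall s, size s = m -> multilinear n (F s)) ->
  multilinear (m + n) (fun s => F (take m s) (drop m s)).
Proof.
move=> Fl Fr s1 s2 s12; have [s1m|s1m] := ltnP (size s1) m.
  have E c : F (take m (s1 ++ c :: s2)) (drop m (s1 ++ c :: s2)) =
      F (s1 ++ c :: take (m - size s1).-1 s2) (drop (m - size s1).-1 s2).
    rewrite take_cat drop_cat !ltnNge (ltnW s1m) /=.
    by move: s1m; rewrite -subn_gt0; case: (m - size s1)%N.
  move=> a c d; rewrite !E.
  apply: (Fl (drop (m - size s1).-1 s2)); rewrite ?size_drop ?size_take;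
    by move: (size s1) (size s2) s12 s1m => k l; try case: ifP; lia.
have E c : F (take m (s1 ++ c :: s2)) (drop m (s1 ++ c :: s2)) =
    F (take m s1) (drop m s1 ++ c :: s2).
  rewrite take_cat drop_cat; case: (ltngtP m (size s1)) s1m => // -> _.
  by rewrite subnn take0 drop0 cats0 take_size drop_size.
move=> a c d; rewrite !E; apply: Fr; first by rewrite size_takel.
by rewrite size_drop; move: (size s1) (size s2) s12 s1m => k l; lia.
Qed.

Lemma ssum_split (V : lmodType K) m n (F : seq C -> seq C -> V) c :
  (forall t, size t = n -> multilinear m (F^~ t)) ->
  (forall s, size s = m -> multilinear n (F s)) ->
  ssum (m + n) (fun s => F (take m s) (drop m s)) c =
  \sum_(p <- sweedler c) ssum m (fun s => ssum n (F s) p.2) p.1.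
Proof.
move=> Fl Fr; rewrite (ssum_cat _ (multilinear_split Fl Fr)).
apply: eq_bigr => p _; apply: eq_ssum => s sm; apply: eq_ssum => t _.
by rewrite take_size_cat // drop_size_cat.
Qed.

(** Isolate the slot k on both sides with ssum_cat. The sums over the l factors
    after it must then be pulled outside before the integrands can be compared. *)
Lemma ssum_subst (V : lmodType K) k n l (F G : seq C -> V) c :
  multilinear (k + (1 + l)) F -> multilinear (k + (n + l)) G ->
  (forall s x t, size s = k -> size t = l ->
     F (s ++ x :: t) = ssum n (fun u => G (s ++ u ++ t)) x) ->
  ssum (k + (1 + l)) F c = ssum (k + (n + l)) G c.
Proof.
move=> FM GM FG; rewrite !ssum_cat //; apply: eq_bigr => p _.
apply: eq_ssum => s sk.
have FsM := multilinear_prefix FM sk; have GsM := multilinear_prefix GM sk.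
rewrite (ssum_cat _ FsM) (ssum_cat _ GsM); apply: eq_bigr => q _.
rewrite ssum_exchange [RHS]ssum_exchange; apply: eq_ssum => t tl.
rewrite ssum1 /=; first exact: FG.
exact: (multilinear_suffix (m := 1) FsM).
Qed.

(** * Symmetry for cocommutative coalgebras *)

Section Symmetry.
Hypothesis CC : cocommutative C.
Variable V : lmodType K.
Implicit Types f : seq C -> V.

Lemma multilinear_rot m n f :
  multilinear (n + m) f -> multilinear (m + n) (fun s => f (rot m s)).
Proof.
move=> fM; apply: (multilinear_split (F := fun s t => f (t ++ s))) => s sz.
  exact: (multilinear_prefix fM sz).
exact: (multilinear_suffix fM sz).
Qed.

(** Exchanging two blocks of factors exchanges the two halves of a single
    coproduct, up to the order of summation. *)
Lemma ssum_rot m n f c : multilinear (n + m) f ->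
  ssum (m + n) (fun s => f (rot m s)) c = ssum (n + m) f c.
Proof.
move=> fM.
have fl t (tn : size t = n) := multilinear_prefix fM tn.
have fr s (sm : size s = m) := multilinear_suffix fM sm.
rewrite (ssum_split (F := fun s t => f (t ++ s)) c fl fr) (ssum_cat _ fM).
rewrite (sweedlerC (g := fun x y =>
  ssum m (fun s => ssum n (fun t => f (t ++ s)) y) x)) //.
- by apply: eq_bigr => p _; rewrite ssum_exchange.
- move=> y; apply: ssum_linear => s1 s2 s12; apply: ssum_param_linear => t tn.
  exact: fl tn _ _ s12.
by move=> x; apply: ssum_param_linear => s sm; apply/ssum_linear/fr.
Qed.

(** The same exchange in front of k further factors, the move that generates all
    rearrangements of a sequence. *)
Lemma ssum_swap k m n f c : multilinear (n + m + k) f ->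
  ssum (m + n + k) (fun s => f (rot m (take (m + n) s) ++ drop (m + n) s)) c =
  ssum (n + m + k) f c.
Proof.
move=> fM.
rewrite (ssum_split (F := fun s t => f (rot m s ++ t))).
- rewrite (ssum_cat _ fM); apply: eq_bigr => p _.
  rewrite ssum_exchange [RHS]ssum_exchange; apply: eq_ssum => t tk.
  exact: (ssum_rot _ (multilinear_suffix fM tk)).
- by move=> t tk; apply: (multilinear_rot (multilinear_suffix fM tk)).
move=> s sz; apply: (multilinear_prefix fM).
by rewrite size_rot sz addnC.
Qed.

(** A permutation is given by the list l of its values. Exchanges of adjacent
    blocks connect l to iota 0 n, and each of them is ssum_swap applied to the
    function f precomposed with the exchange. *)
Lemma ssum_perm n (l : seq nat) f c : perm_eq (iota 0 n) l -> multilinear n f ->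
  ssum n (fun s => f [seq nth 0 s i | i <- l]) c = ssum n f c.
Proof.
pose P l := size l = n -> forall f, multilinear n f ->
  ssum n (fun s => f [seq nth 0 s i | i <- l]) c = ssum n f c.
move=> nl; have : P l; last by apply; rewrite -(perm_size nl) size_iota.
apply: (@catCA_perm_ind _ P _ _ _ nl) => [l1 l2 l3 IH sz g gM|_ g _]; last first.
  apply: eq_ssum => s sn; congr (g _).
  by rewrite -[in LHS]sn -/(mkseq _ _) mkseq_nth.
have e : (size l2 + size l1 + size l3)%N = n by rewrite -sz !size_cat addnA.
have e' : (size l1 + size l2 + size l3)%N = n by rewrite (addnC (size l1)).
have gM' : multilinear (size l2 + size l1 + size l3) g by rewrite e.
pose h s := g (rot (size l1) (take (size l1 + size l2) s) ++
               drop (size l1 + size l2) s).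
have hM : multilinear n h.
  rewrite -e'; apply: (multilinear_split (F := fun s t => g (rot (size l1) s ++ t))).
    by move=> t tk; apply: (multilinear_rot (multilinear_suffix gM' tk)).
  move=> s sk; apply: (multilinear_prefix gM').
  by rewrite size_rot sk addnC.
have hg : ssum n h c = ssum n g c.
  by have := ssum_swap c gM'; rewrite e e'.
have sz' : size (l1 ++ l2 ++ l3) = n by rewrite -sz !size_cat addnCA.
(* h is g precomposed with the exchange that makes l1 ++ l2 ++ l3 into
   l2 ++ l1 ++ l3. *)
rewrite -hg; apply: etrans (IH sz' h hM).
apply: eq_ssum => s _; rewrite /h !map_cat; congr (g _).
rewrite -(size_map (nth 0 s) l1) -(size_map (nth 0 s) l2) -size_cat.
by rewrite (catA [seq _ | i <- l1]) take_size_cat // drop_size_cat // rot_size_cat catA.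
Qed.
End Symmetry.
End IteratedSweedler.

(** * Applying a family of linear maps slot by slot *)

Section Pointwise.
Variables (K : fieldType) (C : coalgebra K) (V W : lmodType K).
Variable phi : C -> {linear V -> W}.

Definition pointwise m (s : seq C) (a : V ^ m) : W ^ m :=
  [ffun i : 'I_m => phi (nth 0 s i) (a i)].

Lemma sweedler_sum_pointwise (X : lmodType K) m (f : W ^ m -> X) (a : V ^ m) c :
  sweedler_sum (fun t : m.-tuple C => f [ffun i : 'I_m => phi (tnth t i) (a i)]) c =
  ssum m (fun s => f (pointwise s a)) c.
Proof.
have E (t : m.-tuple C) : [ffun i : 'I_m => phi (tnth t i) (a i)] = pointwise t a.
  by apply/ffunP => i; rewrite !ffunE (tnth_nth 0).
rewrite /ssum /sweedler_sum.
by case: m f a E => [|m] f a E; rewrite ?E //; apply: eq_bigr => t _; rewrite E.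
Qed.

Lemma pointwise_upd m s (a : V ^ m) i v :
  pointwise s (upd a i v) = upd (pointwise s a) i (phi (nth 0 s i) v).
Proof. by apply/ffunP => j; rewrite !ffunE; case: eqP => [->|]. Qed.

(** The dependence on one factor, in the form in which linearity in an argument
    is stated; the 0 is a placeholder that upd overwrites. *)
Lemma pointwise_slot m s x t (a : V ^ m) (i : 'I_m) : size s = i ->
  pointwise (s ++ x :: t) a =
  upd (pointwise (s ++ 0 :: t) a) i (phi x (a i)).
Proof.
move=> si; apply/ffunP => j; rewrite !ffunE !nth_cat si -val_eqE /=.
case: ltngtP => [||ji] //.
  by rewrite -subn_gt0; case: (j - i)%N.
by rewrite ji subnn /=; congr (phi _ (a _)); apply: ord_inj.
Qed.

Lemma pointwise_cat m n s t (a : V ^ m) (b : V ^ n) : size s = m ->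
  pointwise (s ++ t) (ffcat a b) = ffcat (pointwise s a) (pointwise t b).
Proof.
move=> sm; apply/ffunP => k; rewrite !ffunE nth_cat sm.
by case: (split_ordP k) => i ->; rewrite ffunE // addKn.
Qed.

Hypothesis phi_linear : hom_linear phi.

Lemma multilinear_pointwise (X : lmodType K) m (f : W ^ m -> X) (a : V ^ m) :
  (forall b i, linear (fun w => f (upd b i w))) ->
  multilinear m (fun s => f (pointwise s a)).
Proof.
move=> fL s t st k x y.
have im : (size s < m)%N by rewrite -st ltnS leq_addr.
have E z := pointwise_slot z t a (i := Ordinal im) (erefl (size s)).
by rewrite (E (k *: x + y)) (E x) (E y) phi_linear fL.
Qed.
End Pointwise.

(** * The induced map on enveloping algebras *)

Section EnvelopingMeasuring.
Variables (K : fieldType) (O : operad K) (A B : op_algebra O) (C : coalgebra K).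
Variable phi : C -> {linear A -> B}.
Hypothesis phi_measuring : op_measuring phi.
Hypothesis CC : cocommutative C.

Definition env_ssum (c : C) m (x : O m.+1) (a : A ^ m) : env B :=
  ssum m (fun s => envZ x (pointwise phi s a)) c.

Definition env_map (c : C) : env A -> env B := env_lift (@env_ssum c).

Lemma phi_linear : hom_linear phi. Proof. by case: phi_measuring. Qed.

Lemma phi_act c n (x : O n) (a : A ^ n) :
  phi c (opalg_act x a) = ssum n (fun s => opalg_act x (pointwise phi s a)) c.
Proof.
by case: phi_measuring => _ ->; exact: sweedler_sum_pointwise.
Qed.

Lemma envZ_multilinear m (x : O m.+1) (a : A ^ m) :
  multilinear m (fun s => envZ x (pointwise phi s a)).
Proof. by apply: (multilinear_pointwise phi_linear) => b i; exact: envZ_linearr. Qed.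

Lemma env_ssum_linear m (x : O m.+1) (a : A ^ m) :
  linear (fun c => env_ssum c x a).
Proof. exact/ssum_linear/envZ_multilinear. Qed.

Lemma env_ssum_linl c m (a : A ^ m) : linear (fun x => env_ssum c x a).
Proof. by apply: ssum_param_linear => s _; exact: envZ_linearl. Qed.

Lemma env_ssum_linr c m (x : O m.+1) (a : A ^ m) i :
  linear (fun b => env_ssum c x (upd a i b)).
Proof.
apply: ssum_param_linear => s _ k b b'.
by rewrite !pointwise_upd linearP envZ_linearr.
Qed.

(** The equivariance relation permutes the a_i but not the factors of c that act
    on them; symmetry of the sum makes up for the difference. *)
Lemma env_ssum_perm c m (s : 'S_m) (x : O m.+1) (a : A ^ m) :
  env_ssum c (op_act (lift_last s) x) a = env_ssum c x [ffun i => a (s i)].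
Proof.
pose l := [seq val (s i) | i <- enum 'I_m].
have ml : perm_eq (iota 0 m) l.
  rewrite -val_enum_ord /l (map_comp val s); apply/perm_map/uniq_perm.
  - exact: enum_uniq.
  - by rewrite (map_inj_uniq perm_inj) enum_uniq.
  move=> i; rewrite mem_enum; apply/esym/mapP.
  by exists (s^-1%g i); rewrite ?mem_enum ?permKV.
rewrite /env_ssum -(ssum_perm CC c ml (envZ_multilinear x _)).
apply: eq_ssum => t tm; rewrite envZ_perm; congr envZ.
apply/ffunP => i; rewrite !ffunE; congr (phi _ _).
rewrite /l -map_comp (nth_map i) ?size_enum_ord //.
by rewrite nth_ord_enum.
Qed.

(** If the factor in slot i is itself expanded into the n + 1 factors u, acting
    on the arguments of y, this is the same as acting on all m + n arguments by
    s ++ u ++ t and inserting y afterwards. *)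
Lemma ins_op_pointwise m n (i : 'I_m) (y : O n.+1) (a : A ^ (m + n)) s u t :
  size s = i -> size u = n.+1 ->
  upd (pointwise phi (s ++ 0 :: t) (ins_op i y a)) i
    (opalg_act y (pointwise phi u [ffun k : 'I_n.+1 => a (Ordinal (ins_ord_lt i k))])) =
  ins_op i y (pointwise phi (s ++ u ++ t) a).
Proof.
move=> si un; apply/ffunP => j; rewrite !ffunE /= -val_eqE /=.
case: ltngtP => [ji|ij|_].
- by rewrite !nth_cat si ji.
- rewrite !nth_cat si un ltnNge (ltnW ij) /=.
  (* Past the inserted block, s ++ 0 :: t is shifted by n in s ++ u ++ t. *)
  have -> : (n + j - i < n.+1)%N = false by lia.
  have -> : (n + j < i)%N = false by lia.
  rewrite (_ : n + j - i - n.+1 = j - i.+1)%N; last by lia.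
  by move: ij; rewrite -subn_gt0 subnS; case: (j - i)%N.
congr opalg_act; apply/ffunP => k; rewrite !ffunE; congr (phi _ _) => /=.
by rewrite !nth_cat si un ltnNge leq_addr addKn /= ltn_ord.
Qed.

(** The factor acting on the inserted value y(a_i, ...) is expanded by the
    measuring axiom, and ssum_subst merges the nested sums. *)
Lemma env_ssum_comp c m n (i : 'I_m) (x : O m.+1) (y : O n.+1) (a : A ^ (m + n)) :
  env_ssum c (op_circS (widen_ord (leqnSn m) i) x y) a = env_ssum c x (ins_op i y a).
Proof.
have em : m = (i + (1 + (m - i.+1)))%N by have := ltn_ord i; lia.
have emn : (m + n)%N = (i + (n.+1 + (m - i.+1)))%N by have := ltn_ord i; lia.
pose F s := envZ x (pointwise phi s (ins_op i y a)).
pose G s := envZ (op_circS (widen_ord (leqnSn m) i) x y) (pointwise phi s a).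
have FM : multilinear m F := envZ_multilinear x _.
have GM : multilinear (m + n) G := envZ_multilinear _ a.
suff FG s v t : size s = i -> size t = (m - i.+1)%N ->
    F (s ++ v :: t) = ssum n.+1 (fun u => G (s ++ u ++ t)) v.
  rewrite em in FM; rewrite emn in GM.
  have := ssum_subst c FM GM FG.
  by rewrite -em -emn.
move=> si tl; rewrite /F (pointwise_slot _ _ _ _ si) ffunE ltnn eqxx phi_act.
rewrite (linear_ssum _ _ _ (envZ_linearr _ _ _)); apply: eq_ssum => u un.
by rewrite /G envZ_comp ins_op_pointwise.
Qed.

Lemma env_mapE c m (x : O m.+1) (a : A ^ m) : env_map c (envZ x a) = env_ssum c x a.
Proof.
exact: env_liftE (@env_ssum_linl c) (@env_ssum_linr c) (@env_ssum_perm c)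
  (@env_ssum_comp c) m x a.
Qed.

Lemma env_map_linear c : linear (env_map c).
Proof.
exact: env_lift_linear (@env_ssum_linl c) (@env_ssum_linr c) (@env_ssum_perm c)
  (@env_ssum_comp c).
Qed.

Lemma env_map_linearl u : linear (env_map^~ u).
Proof.
move=> k c d; move: u.
apply: (env_ext (g := fun u => k *: env_map c u + env_map d u)).
- exact: env_map_linear.
- by apply: linear_comb; exact: env_map_linear.
by move=> m x a; rewrite !env_mapE env_ssum_linear.
Qed.

Lemma env_mapM c u v :
  env_map c (env_mul u v) =
  \sum_(p <- sweedler c) env_mul (env_map p.1 u) (env_map p.2 v).
Proof.
move: u; apply: (env_ext (f := fun u => env_map c (env_mul u v))).
- by move=> k u u'; rewrite env_mul_linearl env_map_linear.
- apply: sum_linear_fun => p k u u'.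
  by rewrite env_map_linear env_mul_linearl.
move=> m x a; move: v; apply: env_ext.
- by move=> k u u'; rewrite env_mul_linearr env_map_linear.
- apply: sum_linear_fun => p k u u'.
  by rewrite env_map_linear env_mul_linearr.
move=> l y b; rewrite env_mulE env_mapE /env_ssum ssum_cat; last exact: envZ_multilinear.
apply: eq_bigr => p _; rewrite !env_mapE /env_ssum.
rewrite (linear_ssum _ _ _ (env_mul_linearl _)); apply: eq_ssum => s sm.
rewrite (linear_ssum _ _ _ (env_mul_linearr _)); apply: eq_ssum => t tl.
by rewrite env_mulE pointwise_cat.
Qed.

Lemma env_map1 c : env_map c (env_one A) = counit C c *: env_one B.
Proof.
rewrite env_mapE /env_ssum ssum0; congr (_ *: envZ _ _).
by apply/ffunP => -[].
Qed.
End EnvelopingMeasuring.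

Theorem theorem1p5 (K : fieldType) (O : operad K) (A B : op_algebra O)
    (C : coalgebra K) (phi : C -> {linear A -> B})
    (phi_measuring : op_measuring phi) (C_cocomm : cocommutative C) :
  exists Phi : C -> {linear env_alg A -> env_alg B},
    [/\ env_induced phi Phi,
        forall Psi : C -> {linear env_alg A -> env_alg B},
          env_induced phi Psi -> forall (c : C) (u : env_alg A), Psi c u = Phi c u
      & alg_measuring Phi].
Proof.
have mapL := env_map_linear phi_measuring C_cocomm.
pose Phi c : {linear env_alg A -> env_alg B} := HB.pack (env_map phi c)
  (GRing.isLinear.Build K (env_alg A) (env_alg B) *:%R _ (mapL c)).
have PhiL : hom_linear Phi by exact: env_map_linearl.
have PhiZ c m (x : O m.+1) (a : A ^ m) : Phi c (envZ x a) =
    sweedler_sum (fun t : m.-tuple C => envZ x [ffun i => phi (tnth t i) (a i)]) c.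
  by rewrite sweedler_sum_pointwise; exact: env_mapE.
exists Phi; split; first by split.
- move=> Psi [_ PsiZ] c; apply: (env_ext (f := Psi c) (g := Phi c)).
  + exact: linearP.
  + exact: linearP.
  by move=> m x a; rewrite PsiZ PhiZ.
split=> //; first exact: env_mapM.
exact: env_map1.
Qed.
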